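(* Let $0<q<1$. Let $m\in\mathbb{Z}$ and let $R,x,y,\nu\in\mathbb{C}$ satisfy $R\neq 0$, $\Re(x)>-1$ and $q^{1+\Re(x)+\Re(y)}|R|^2<1$. Then $$ (-1)^m q^{-\frac12 m}\,J_m\bigl(Rq^{\frac12(x+y)};q\bigr)\,J_{\nu-m}\bigl(Rq^{\frac12(y+\nu-m)};q\bigr) =\sum_{z=-\infty}^{\infty} q^z\,J_x\bigl(q^{\frac12(m+z)};q\bigr)\,J_{x-\nu}\bigl(q^{\frac12 z};q\bigr)\,J_\nu\bigl(Rq^{\frac12(y+\nu+z)};q\bigr). $$
   Context: For $0<q<1$ put $(a;q)_0=1$, $(a;q)_k=\prod_{i=0}^{k-1}(1-aq^i)$ for $k\ge 1$, and $(a;q)_\infty=\lim_{k\to\infty}(a;q)_k$. The Hahn-Exton $q$-Bessel function of order $\alpha\in\mathbb{C}$ is $$ J_\alpha(z;q)=z^\alpha\frac{(q^{\alpha+1};q)_\infty}{(q;q)_\infty}\,{}_1\varphi_1\!\left({0\atop q^{\alpha+1}};q,qz^2\right) = z^\alpha \sum_{k=0}^\infty \frac{(q^{\alpha+k+1};q)_\infty}{(q;q)_\infty}\,\frac{(-1)^k q^{\frac12 k(k+1)}}{(q;q)_k}\,z^{2k}, $$ where the last expression is used as the definition also when $(q^{\alpha+1};q)_k$ vanishes for some $k$ (e.g. when $\alpha$ is a negative integer). Powers: $q^a=e^{a\log q}$ with $\log q$ real, for all $a\in\mathbb{C}$. One fixes a value of $\log R$ and puts $R^\alpha=e^{\alpha\log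 R}$; then $z^\alpha$ for $z=Rq^a$ means $R^\alpha q^{a\alpha}$, and for $z=q^a$ means $q^{a\alpha}$. *)

(* Defs.v *)
From Stdlib Require Export Reals ZArith.
From Coquelicot Require Export Coquelicot.

Local Open Scope C_scope.

Definition Cexp (z : C) : C :=
  ((exp (Re z) * cos (Im z))%R, (exp (Re z) * sin (Im z))%R).

Definition qpow (q : R) (a : C) : C := Cexp (a * RtoC (ln q)).

Fixpoint qpoch (q : R) (a : C) (k : nat) : C :=
  match k with
  | O => RtoC 1
  | S n => qpoch q a n * (RtoC 1 - a * RtoC (q ^ n)%R)
  end.

(* [iota] picks the unique element satisfying a predicate; the value is
   unspecified when the limit, resp. the sum, does not exist. *)
Definition qpoch_inf (q : R) (a : C) : C :=
  iota (T := C_CompleteNormedModule)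
    (fun l : C_CompleteNormedModule =>
       filterlim (qpoch q a) eventually (locally l)).

Definition CSeries (u : nat -> C) : C :=
  iota (T := C_CompleteNormedModule)
    (fun l : C_CompleteNormedModule =>
       is_series (V := C_NormedModule) u l).

(* The argument [zalpha] is the chosen value of the multivalued power
   z ^ alpha.  The natural number division below is exact. *)
Definition hahn_exton (q : R) (alpha z zalpha : C) : C :=
  zalpha *
  CSeries (fun k : nat =>
    qpoch_inf q (qpow q (alpha + RtoC (INR k) + RtoC 1))
      / qpoch_inf q (RtoC q)
    * (RtoC ((-1) ^ k * q ^ (k * (k + 1) / 2))%R / qpoch q (RtoC q) k)
    * z ^ (2 * k)).

(* J_alpha (r q^a; q), where [lr] is the fixed value of log r:
   z ^ alpha is read as r ^ alpha * q ^ (a * alpha), r ^ alpha = e ^ (alpha * lr). *)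
Definition hahn_exton_at (q : R) (alpha r lr a : C) : C :=
  hahn_exton q alpha (r * qpow q a) (Cexp (alpha * lr) * qpow q (a * alpha)).

(* J_alpha (q^a; q), where z ^ alpha is read as q ^ (a * alpha). *)
Definition hahn_exton_q (q : R) (alpha a : C) : C :=
  hahn_exton q alpha (qpow q a) (qpow q (a * alpha)).

(* Both one-sided series converge, and their sums add up to [s]. *)
Definition is_bilateral_series (f : Z -> C) (s : C) : Prop :=
  exists s1 s2 : C,
    is_series (V := C_NormedModule) (fun n : nat => f (Z.of_nat n)) s1 /\
    is_series (V := C_NormedModule) (fun n : nat => f (- Z.of_nat (S n))%Z) s2 /\
    s = s1 + s2.

(* Main.v *)
Require Import Defs.
From Stdlib Require Import List Permutation Classical Lia Lra.

(** Write $h(n)=1/(q;q)_n$ for $n\ge0$ and $h(n)=0$ for $n<0$, and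
    $g(\beta)=(q^{\beta+1};q)_\infty/(q;q)_\infty$, so that $g(n)=h(n)$ at every integer.
    Then
    $$J_\alpha(q^{a/2};q)=\sum_{k\in\mathbf Z}(-1)^k q^{k(k+1)/2+ak+a\alpha/2}\,h(k)\,g(\alpha+k),$$
    and all summation ranges can be taken to be $\mathbf Z$.  The base point $R$ is itself
    a power $q^\rho$, $\rho=\log R/\log q$, and is absorbed into $y$
    ([hahn_exton_at_heJ]), so only the functions [heJ] $=J_\alpha(q^{a/2};q)$ occur.

    Expanding $(q^{\alpha+k+1};q)_\infty$ by Euler's formula ([euler]) turns the displayed
    sum into a double sum symmetric in $\alpha$ and $a$; hence
    $J_x(q^{n/2};q)=J_n(q^{x/2};q)$ ([heJ_sym]).  After this exchange in the first two
    Bessel factors, the right-hand side of the theorem becomes a fourfold sum over $(z,i,j,k)$,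
    where $i,j,k$ are the expansion indices of the three factors.  It converges
    absolutely ([quad_term_bounded]): for $z\ge0$ the decay in $z$ is $q^{(1+\Re x)z}$, and for
    $z<0$ the factors $h(m+z+i)h(z+j)$ force $i\ge -z-m$ and $j\ge -z$, so that the Gaussian
    factors in $i$, $j$ and $k$ dominate the growth $q^{zk}$.

    The terms may therefore be regrouped by $z=p-i-j$, $k=p+l$.  This is the same as
    multiplying out the generating functions
    $\sum_n t^nJ_n(a;q)=(qa/t;q)_\infty/(at;q)_\infty$ crosswise, the factors in $t$ together
    and the factors in $1/t$ together.  For fixed $p,l$ the sums over $i$ and over $j$
    separate, and each is the terminating q-binomial sum [gauss_hasSum].  What is left is
    the product of the series of $J_m$ (over $p$) and of $J_{\nu-m}$ (over $l$). *)

Local Open Scope C_scope.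

(** * Unordered sums of complex families *)

Definition lsum {I : Type} (f : I -> C) (l : list I) : C :=
  fold_right (fun i s => f i + s) 0 l.

Definition rsum {I : Type} (f : I -> R) (l : list I) : R :=
  fold_right (fun i s => (f i + s)%R) 0%R l.

(** Convergence along the directed set of finite subsets, represented by duplicate-free
    lists.  No order on the index type is involved, so changes of summation variables are
    plain reindexings. *)
Definition hasSum {I : Type} (f : I -> C) (s : C) : Prop :=
  forall eps : R, (0 < eps)%R ->
    exists l0 : list I, forall l, NoDup l -> incl l0 l ->
      (Cmod (lsum f l - s) < eps)%R.

(** For a nonnegative family this is summability. *)
Definition sum_bounded {I : Type} (f : I -> R) (B : R) : Prop :=
  forall l, NoDup l -> (rsum f l <= B)%R.

Definition abs_bounded {I : Type} (f : I -> C) : Prop :=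
  exists B, sum_bounded (fun i => Cmod (f i)) B.

Lemma lsum_app {I} (f : I -> C) l1 l2 : lsum f (l1 ++ l2) = lsum f l1 + lsum f l2.
Proof. induction l1 as [|a l1 IH]; simpl; [ring|]. rewrite IH. ring. Qed.

Lemma rsum_app {I} (f : I -> R) l1 l2 :
  rsum f (l1 ++ l2) = (rsum f l1 + rsum f l2)%R.
Proof. induction l1 as [|a l1 IH]; simpl; [ring|]. rewrite IH. ring. Qed.

Lemma lsum_map {I J} (f : I -> C) (phi : J -> I) l :
  lsum f (map phi l) = lsum (fun j => f (phi j)) l.
Proof. induction l as [|a l IH]; simpl; congruence. Qed.

Lemma rsum_map {I J} (f : I -> R) (phi : J -> I) l :
  rsum f (map phi l) = rsum (fun j => f (phi j)) l.
Proof. induction l as [|a l IH]; simpl; congruence. Qed.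

Lemma rsum_nonneg {I} (f : I -> R) l : (forall i, 0 <= f i)%R -> (0 <= rsum f l)%R.
Proof.
  intros Hf; induction l as [|a l IH]; simpl; [lra|]. specialize (Hf a); lra.
Qed.

Lemma rsum_le {I} (f g : I -> R) l :
  (forall i, f i <= g i)%R -> (rsum f l <= rsum g l)%R.
Proof.
  intros Hf; induction l as [|a l IH]; simpl; [lra|]. specialize (Hf a); lra.
Qed.

Lemma rsum_scal {I} (c : R) (f : I -> R) l :
  rsum (fun i => c * f i)%R l = (c * rsum f l)%R.
Proof. induction l as [|a l IH]; simpl; [ring|]. rewrite IH. ring. Qed.

Lemma rsum_incl {I} (f : I -> R) l l' :
  (forall i, 0 <= f i)%R -> NoDup l -> incl l l' -> (rsum f l <= rsum f l')%R.
Proof.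
  intros Hf. revert l'. induction l as [|a l IH]; intros l' Hnd Hincl.
  - now apply rsum_nonneg.
  - destruct (in_split a l') as (l1 & l2 & ->); [apply Hincl; now left|].
    inversion Hnd; subst.
    assert (rsum f l <= rsum f (l1 ++ l2))%R as Hle.
    { apply IH; auto. intros b Hb.
      assert (In b (l1 ++ a :: l2)) as Hb' by (apply Hincl; now right).
      apply in_app_or in Hb'. apply in_or_app.
      destruct Hb' as [|[->|]]; auto. contradiction. }
    rewrite rsum_app in *. simpl. lra.
Qed.

Lemma Cmod_lsum_le {I} (f : I -> C) l :
  (Cmod (lsum f l) <= rsum (fun i => Cmod (f i)) l)%R.
Proof.
  induction l as [|a l IH]; simpl.
  - rewrite Cmod_0; lra.
  - eapply Rle_trans; [apply Cmod_triangle|]. lra.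
Qed.

Lemma dedup {I : Type} (l : list I) : exists l', NoDup l' /\ incl l l' /\ incl l' l.
Proof.
  induction l as [|a l (l' & Hnd & H1 & H2)].
  - exists nil. repeat split; [constructor|intros ? []..].
  - destruct (classic (In a l')) as [Ha|Ha].
    + exists l'. repeat split; auto.
      * intros b [->|Hb]; auto.
      * intros b Hb; right; auto.
    + exists (a :: l'). repeat split.
      * now constructor.
      * intros b [->|Hb]; [now left|right; auto].
      * intros b [->|Hb]; [now left|right; auto].
Qed.

(** * Elementary rules *)

Lemma hasSum_unique {I} (f : I -> C) s s' :
  hasSum f s -> hasSum f s' -> s = s'.
Proof.
  intros H H'. destruct (classic (s = s')) as [|Hne]; auto. exfalso.
  assert (0 < Cmod (s - s'))%R as Hpos by (apply Cmod_gt_0; now apply Cminus_eq_contra).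
  destruct (H (Cmod (s - s') / 2)%R) as [l0 Hl0]; [lra|].
  destruct (H' (Cmod (s - s') / 2)%R) as [l1 Hl1]; [lra|].
  destruct (dedup (l0 ++ l1)) as (l & Hnd & Hi & _).
  specialize (Hl0 l Hnd (incl_tran (incl_appl _ (incl_refl _)) Hi)).
  specialize (Hl1 l Hnd (incl_tran (incl_appr _ (incl_refl _)) Hi)).
  assert (Cmod (s - s') <= Cmod (lsum f l - s) + Cmod (lsum f l - s'))%R; [|lra].
  replace (s - s') with (- (lsum f l - s) + (lsum f l - s')) by ring.
  rewrite <- (Cmod_opp (lsum f l - s)). apply Cmod_triangle.
Qed.

Lemma lsum_ext {I} (f g : I -> C) l : (forall i, f i = g i) -> lsum f l = lsum g l.
Proof. intros H; induction l as [|a l IH]; simpl; congruence. Qed.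

Lemma hasSum_ext {I} (f g : I -> C) s :
  (forall i, f i = g i) -> hasSum f s -> hasSum g s.
Proof.
  intros H Hf eps Heps. destruct (Hf eps Heps) as [l0 Hl0]. exists l0.
  intros l Hnd Hi. rewrite <- (lsum_ext f g l H). auto.
Qed.

Lemma lsum_scal {I} (c : C) (f : I -> C) l :
  lsum (fun i => c * f i) l = c * lsum f l.
Proof. induction l as [|a l IH]; simpl; [ring|]. rewrite IH. ring. Qed.

Lemma lsum_plus {I} (f g : I -> C) l :
  lsum (fun i => f i + g i) l = lsum f l + lsum g l.
Proof. induction l as [|a l IH]; simpl; [ring|]. rewrite IH. ring. Qed.

Lemma hasSum_scal {I} (c : C) (f : I -> C) s :
  hasSum f s -> hasSum (fun i => c * f i) (c * s).
Proof.
  intros Hf eps Heps. pose proof (Cmod_ge_0 c) as Hc.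
  destruct (Hf (eps / (Cmod c + 1))%R) as [l0 Hl0]; [apply Rdiv_lt_0_compat; lra|].
  exists l0. intros l Hnd Hi. specialize (Hl0 l Hnd Hi).
  rewrite lsum_scal. replace (c * lsum f l - c * s) with (c * (lsum f l - s)) by ring.
  rewrite Cmod_mult.
  pose proof (Cmod_ge_0 (lsum f l - s)).
  apply (Rmult_lt_compat_r (Cmod c + 1)) in Hl0; [|lra].
  unfold Rdiv in Hl0. rewrite Rmult_assoc, Rinv_l in Hl0 by lra. nra.
Qed.

Lemma hasSum_plus {I} (f g : I -> C) s t :
  hasSum f s -> hasSum g t -> hasSum (fun i => f i + g i) (s + t).
Proof.
  intros Hf Hg eps Heps.
  destruct (Hf (eps / 2)%R) as [l0 Hl0]; [lra|].
  destruct (Hg (eps / 2)%R) as [l1 Hl1]; [lra|].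
  exists (l0 ++ l1). intros l Hnd Hi.
  specialize (Hl0 l Hnd (incl_tran (incl_appl _ (incl_refl _)) Hi)).
  specialize (Hl1 l Hnd (incl_tran (incl_appr _ (incl_refl _)) Hi)).
  rewrite lsum_plus.
  replace (lsum f l + lsum g l - (s + t)) with ((lsum f l - s) + (lsum g l - t)) by ring.
  eapply Rle_lt_trans; [apply Cmod_triangle|]. lra.
Qed.

Lemma hasSum_zero {I} (f : I -> C) : (forall i, f i = 0) -> hasSum f 0.
Proof.
  intros Hf eps Heps. exists nil. intros l _ _.
  replace (lsum f l) with (RtoC 0).
  - replace (0 - 0) with (RtoC 0) by ring. now rewrite Cmod_0.
  - induction l as [|a l IH]; simpl; auto. rewrite Hf, <- IH. ring.
Qed.

Lemma hasSum_single {I} (f : I -> C) i0 :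
  (forall i, i <> i0 -> f i = 0) -> hasSum f (f i0).
Proof.
  intros Hf eps Heps. exists (i0 :: nil). intros l Hnd Hi.
  replace (lsum f l) with (f i0).
  - replace (f i0 - f i0) with (RtoC 0) by ring. now rewrite Cmod_0.
  - assert (forall l', ~ In i0 l' -> lsum f l' = 0) as H0.
    { induction l' as [|a l' IH]; simpl; intros Hni; auto.
      rewrite Hf, IH; [ring|tauto..]. }
    destruct (in_split i0 l) as (l1 & l2 & ->); [apply Hi; now left|].
    apply NoDup_remove_2 in Hnd.
    rewrite lsum_app. simpl. rewrite !H0; [ring| |];
      intros ?; apply Hnd; apply in_or_app; auto.
Qed.

Lemma hasSum_norm_le {I} (f : I -> C) s B :
  hasSum f s -> sum_bounded (fun i => Cmod (f i)) B -> (Cmod s <= B)%R.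
Proof.
  intros Hs HB. apply Rnot_lt_le. intros Hlt.
  destruct (Hs (Cmod s - B)%R) as [l0 Hl0]; [lra|].
  destruct (dedup l0) as (l & Hnd & Hi & _).
  specialize (Hl0 l Hnd Hi). specialize (HB l Hnd).
  pose proof (Cmod_lsum_le f l).
  assert (Cmod s <= Cmod (lsum f l - s) + Cmod (lsum f l))%R; [|lra].
  replace s with (- (lsum f l - s) + lsum f l) at 1 by ring.
  rewrite <- (Cmod_opp (lsum f l - s)). apply Cmod_triangle.
Qed.

(** Indices of $l_0$ missing from $l$ can be added for free, since the family vanishes there. *)
Lemma lsum_absorb {I} (f : I -> C) l0 l :
  NoDup l -> (forall i, In i l0 -> f i <> 0 -> In i l) ->
  exists l', NoDup l' /\ incl l l' /\ incl l0 l' /\ lsum f l' = lsum f l.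
Proof.
  intros Hnd. induction l0 as [|a l0 IH]; intros H.
  - exists l. repeat split; auto using incl_refl. intros ? [].
  - destruct IH as (l' & Hnd' & H1 & H2 & H3).
    { intros i Hi; apply H; now right. }
    destruct (classic (In a l')) as [Ha|Ha].
    + exists l'. repeat split; auto. intros b [->|Hb]; auto.
    + assert (f a = 0) as Hfa.
      { destruct (classic (f a = 0)); auto. exfalso. apply Ha, H1, H; auto. now left. }
      exists (a :: l'). repeat split.
      * now constructor.
      * intros b Hb; right; auto.
      * intros b [->|Hb]; [now left|right; auto].
      * simpl. rewrite Hfa, H3. ring.
Qed.

(** Covers both changes of variables by bijections and the passage from $\mathbf Z$ to
    $\mathbf N$ for families vanishing at negative indices. *)
Lemma hasSum_reindex {I J} (phi : J -> I) (f : I -> C) s :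
  (forall j j', phi j = phi j' -> j = j') ->
  (forall i, f i <> 0 -> exists j, phi j = i) ->
  hasSum f s -> hasSum (fun j => f (phi j)) s.
Proof.
  intros Hinj Hsup Hf eps Heps. destruct (Hf eps Heps) as [l0 Hl0].
  assert (exists m0, forall i, In i l0 -> f i <> 0 ->
                       exists j, In j m0 /\ phi j = i) as [m0 Hm0].
  { clear Hl0. induction l0 as [|a l0 [m0 IH]].
    - exists nil. intros i [].
    - destruct (classic (f a = 0)) as [Ha|Ha].
      + exists m0. intros i [->|Hi] Hne; [contradiction|auto].
      + destruct (Hsup a Ha) as [j Hj]. exists (j :: m0).
        intros i [->|Hi] Hne.
        * exists j; split; auto. now left.
        * destruct (IH i Hi Hne) as (j' & ? & ?). exists j'; split; auto. now right. }
  exists m0. intros m Hnd Hi.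
  destruct (lsum_absorb f l0 (map phi m)) as (l & Hndl & _ & Hil & Heq).
  - now apply FinFun.Injective_map_NoDup.
  - intros i Hin Hne. destruct (Hm0 i Hin Hne) as (j & Hj & <-).
    apply in_map; auto.
  - rewrite <- lsum_map, <- Heq. auto.
Qed.

Lemma abs_bounded_inj {I J} (phi : J -> I) (f : I -> C) :
  (forall j j', phi j = phi j' -> j = j') ->
  abs_bounded f -> abs_bounded (fun j => f (phi j)).
Proof.
  intros Hinj [B HB]. exists B. intros l Hnd.
  specialize (HB (map phi l) (FinFun.Injective_map_NoDup Hinj Hnd)).
  now rewrite rsum_map in HB.
Qed.

(** * Absolute convergence *)

Lemma hasSum_nonneg {I} (f : I -> R) B :
  (forall i, 0 <= f i)%R -> sum_bounded f B ->
  exists s : R, hasSum (fun i => RtoC (f i)) s.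
Proof.
  intros Hf HB.
  destruct (completeness (fun x => exists l, NoDup l /\ x = rsum f l)) as [s [Hub Hlub]].
  - exists B. intros x (l & Hnd & ->). auto.
  - exists 0%R, nil. split; [constructor|reflexivity].
  - exists s. intros eps Heps.
    assert (exists l0, NoDup l0 /\ (s - eps < rsum f l0)%R) as (l0 & Hnd0 & Hl0).
    { apply NNPP. intros Hno. assert (s <= s - eps)%R; [|lra].
      apply Hlub. intros x (l & Hnd & ->). apply Rnot_lt_le.
      intros Hlt. apply Hno. eauto. }
    exists l0. intros l Hnd Hi.
    assert (lsum (fun i => RtoC (f i)) l = RtoC (rsum f l)) as ->.
    { clear. induction l as [|a l IH]; simpl; auto. now rewrite IH, RtoC_plus. }
    rewrite <- RtoC_minus, Cmod_R.
    assert (rsum f l <= s)%R by (apply Hub; eauto).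
    pose proof (rsum_incl f l0 l Hf Hnd0 Hi).
    rewrite Rabs_left1; lra.
Qed.

Lemma sum_bounded_le {I} (f g : I -> R) B :
  (forall i, f i <= g i)%R -> sum_bounded g B -> sum_bounded f B.
Proof.
  intros H HB l Hnd. eapply Rle_trans; [now apply rsum_le|auto].
Qed.

Lemma sum_bounded_scal {I} (f : I -> R) c B :
  (0 <= c)%R -> sum_bounded f B -> sum_bounded (fun i => c * f i)%R (c * B)%R.
Proof.
  intros Hc HB l Hnd. rewrite rsum_scal. apply Rmult_le_compat_l; auto.
Qed.

(** Completeness: the real and imaginary parts $u$ satisfy $|u|\le|f|$, so
    $u=(u+|f|)-|f|$ is a difference of nonnegative families with bounded finite sums. *)
Lemma abs_bounded_hasSum {I} (f : I -> C) :
  abs_bounded f -> exists s, hasSum f s.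
Proof.
  intros [B HB].
  assert (forall u : I -> R, (forall i, Rabs (u i) <= Cmod (f i))%R ->
    exists s : C, hasSum (fun i => RtoC (u i)) s) as Hreal.
  { intros u Hu.
    destruct (hasSum_nonneg (fun i => (u i + Cmod (f i))%R) (2 * B)) as [s Hs].
    - intros i. specialize (Hu i).
      unfold Rabs in Hu. destruct (Rcase_abs (u i)); lra.
    - apply sum_bounded_le with (fun i => 2 * Cmod (f i))%R.
      + intros i. specialize (Hu i). pose proof (Rle_abs (u i)). lra.
      + apply sum_bounded_scal; [lra|auto].
    - destruct (hasSum_nonneg (fun i => Cmod (f i)) B) as [t Ht]; auto.
      { intros i; apply Cmod_ge_0. }
      exists (RtoC s + (-1) * RtoC t).
      apply hasSum_ext with
        (fun i => RtoC (u i + Cmod (f i)) + (-1) * RtoC (Cmod (f i))).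
      + intros i. rewrite RtoC_plus. ring.
      + apply hasSum_plus; auto. now apply hasSum_scal. }
  destruct (Hreal (fun i => Re (f i))) as [s Hs].
  { intros i. apply re_le_Cmod. }
  destruct (Hreal (fun i => Im (f i))) as [t Ht].
  { intros i. pose proof (Rmax_Cmod (f i)). pose proof (Rmax_r (Rabs (fst (f i))) (Rabs (snd (f i)))).
    unfold Im. lra. }
  exists (s + Ci * t).
  apply hasSum_ext with (fun i => RtoC (Re (f i)) + Ci * RtoC (Im (f i))).
  - intros i. destruct (f i) as [a b]. unfold Ci, Re, Im, RtoC, Cplus, Cmult; simpl.
    f_equal; ring.
  - apply hasSum_plus; auto. now apply hasSum_scal.
Qed.

Lemma abs_bounded_le {I} (f : I -> C) (g : I -> R) c B :
  (0 <= c)%R -> sum_bounded g B -> (forall i, Cmod (f i) <= c * g i)%R -> abs_bounded f.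
Proof.
  intros Hc HB Hle. exists (c * B)%R.
  apply sum_bounded_le with (fun i => c * g i)%R; auto. now apply sum_bounded_scal.
Qed.

Lemma sum_bounded_prod {I J} (f : I -> R) (g : J -> R) B B' :
  (forall i, 0 <= f i)%R -> (forall j, 0 <= g j)%R ->
  sum_bounded f B -> sum_bounded g B' ->
  sum_bounded (fun p => f (fst p) * g (snd p))%R (B * B')%R.
Proof.
  intros Hf Hg HB HB' l Hnd.
  destruct (dedup (map fst l)) as (l1 & Hnd1 & Hi1 & _).
  destruct (dedup (map snd l)) as (l2 & Hnd2 & Hi2 & _).
  apply Rle_trans with (rsum (fun p => f (fst p) * g (snd p))%R (list_prod l1 l2)).
  - apply rsum_incl; auto.
    + intros i; apply Rmult_le_pos; auto.
    + intros [i j] Hij. apply in_prod.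
      * apply Hi1. now apply (in_map fst) in Hij.
      * apply Hi2. now apply (in_map snd) in Hij.
  - assert (rsum (fun p => f (fst p) * g (snd p))%R (list_prod l1 l2)
            = (rsum f l1 * rsum g l2)%R) as ->.
    { clear. induction l1 as [|a l1 IH]; simpl; [ring|].
      rewrite rsum_app, IH, rsum_map. simpl. rewrite rsum_scal. ring. }
    apply Rmult_le_compat; auto using rsum_nonneg.
Qed.

(** * Summation in stages *)

(** The finite step behind both statements on iterated sums below: over each index in $l$
    choose a finite part of the fibre large enough to contain the part of $l_0$ above it and
    to come close to the fibre total; $u$ is the union of these parts. *)
Lemma fiberwise_approx {I J} (f : I * J -> C) (g : I -> C) (l0 : list (I * J)) l eps :
  (0 < eps)%R -> NoDup l -> (forall i, hasSum (fun j => f (i, j)) (g i)) ->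
  exists u, NoDup u /\ (forall p, In p u -> In (fst p) l) /\
    (forall p, In p l0 -> In (fst p) l -> In p u) /\
    (Cmod (lsum f u - lsum g l) <= INR (length l) * eps)%R /\
    (rsum (fun i => Cmod (g i)) l <= rsum (fun p => Cmod (f p)) u + INR (length l) * eps)%R.
Proof.
  intros Heps Hnd Hg. induction l as [|i l IH].
  - exists nil. simpl. split; [constructor|]. split; [tauto|]. split; [tauto|].
    replace (0 - 0) with (RtoC 0) by ring. rewrite Cmod_0. lra.
  - inversion Hnd as [|? ? Hni Hnd']; subst.
    destruct (IH Hnd') as (u & Hu1 & Hu2 & Hu3 & Hu4 & Hu5). clear IH.
    destruct (Hg i eps Heps) as [m0 Hm0].
    destruct (dedup (m0 ++ map snd l0)) as (m & Hm1 & Hm2 & _).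
    assert (Hi1 := incl_app_inv _ _ Hm2). destruct Hi1 as [Hi1 Hi2].
    specialize (Hm0 m Hm1 Hi1).
    exists (map (fun j => (i, j)) m ++ u).
    assert (lsum f (map (fun j => (i, j)) m ++ u)
            = lsum (fun j => f (i, j)) m + lsum f u) as E
      by (now rewrite lsum_app, lsum_map).
    split; [|split; [|split; [|split]]].
    + apply NoDup_app; auto.
      * apply FinFun.Injective_map_NoDup; auto. intros ? ? [=]; auto.
      * intros p Hp Hp'. apply in_map_iff in Hp. destruct Hp as (j & <- & _).
        apply Hu2 in Hp'. contradiction.
    + intros p Hp. apply in_app_or in Hp. destruct Hp as [Hp|Hp].
      * apply in_map_iff in Hp. destruct Hp as (j & <- & _). now left.
      * right; auto.
    + intros [i' j] Hp [Heq|Hin]; apply in_or_app.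
      * left. simpl in Heq. subst i'. apply in_map. apply Hi2.
        now apply (in_map snd) in Hp.
      * right. auto.
    + rewrite E. simpl lsum. simpl length. rewrite S_INR.
      replace (lsum (fun j => f (i, j)) m + lsum f u - (g i + lsum g l))
        with ((lsum (fun j => f (i, j)) m - g i) + (lsum f u - lsum g l)) by ring.
      eapply Rle_trans; [apply Cmod_triangle|]. lra.
    + rewrite rsum_app, rsum_map. simpl rsum. simpl length. rewrite S_INR.
      pose proof (Cmod_lsum_le (fun j => f (i, j)) m).
      assert (Cmod (g i) <= Cmod (lsum (fun j => f (i, j)) m - g i)
                           + Cmod (lsum (fun j => f (i, j)) m))%R.
      { replace (g i) with (- (lsum (fun j => f (i, j)) m - g i)
                              + lsum (fun j => f (i, j)) m) at 1 by ring.
        rewrite <- (Cmod_opp (lsum (fun j => f (i, j)) m - g i)).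
        apply Cmod_triangle. }
      lra.
Qed.

(** Only the outer sum of the iterated sum needs an argument: its finite partial sums are
    approximated by finite partial sums of the double family. *)
Lemma hasSum_fiberwise {I J} (f : I * J -> C) (g : I -> C) s :
  hasSum f s -> (forall i, hasSum (fun j => f (i, j)) (g i)) -> hasSum g s.
Proof.
  intros Hf Hg eps Heps.
  destruct (Hf (eps / 2)%R) as [l0 Hl0]; [lra|].
  exists (map fst l0). intros l Hnd Hi.
  pose proof (pos_INR (length l)) as Hlen.
  destruct (fiberwise_approx f g l0 l (eps / 2 / (INR (length l) + 1)))
    as (u & Hu1 & Hu2 & Hu3 & Hu4 & _); auto.
  { apply Rdiv_lt_0_compat; lra. }
  assert (Cmod (lsum f u - s) < eps / 2)%R as H1.
  { apply Hl0; auto. intros p Hp. apply Hu3; auto. apply Hi. now apply in_map. }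
  assert (INR (length l) * (eps / 2 / (INR (length l) + 1)) < eps / 2)%R as H2.
  { replace (INR (length l) * (eps / 2 / (INR (length l) + 1)))%R
      with (eps / 2 * (INR (length l) / (INR (length l) + 1)))%R by (field; lra).
    rewrite <- (Rmult_1_r (eps / 2)) at 2. apply Rmult_lt_compat_l; [lra|].
    apply Rmult_lt_reg_r with (INR (length l) + 1)%R; [lra|].
    unfold Rdiv. rewrite Rmult_assoc, Rinv_l; lra. }
  replace (lsum g l - s) with (- (lsum f u - lsum g l) + (lsum f u - s)) by ring.
  eapply Rle_lt_trans; [apply Cmod_triangle|]. rewrite Cmod_opp. lra.
Qed.

Lemma abs_bounded_fiberwise {I J} (f : I * J -> C) (g : I -> C) :
  abs_bounded f -> (forall i, hasSum (fun j => f (i, j)) (g i)) -> abs_bounded g.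
Proof.
  intros [B HB] Hg. exists B. intros l Hnd. apply Rnot_lt_le. intros Hlt.
  set (d := (rsum (fun i => Cmod (g i)) l - B)%R) in *.
  assert (0 < d)%R as Hd by (unfold d; lra).
  pose proof (pos_INR (length l)) as Hlen.
  destruct (fiberwise_approx f g nil l (d / (INR (length l) + 1)))
    as (u & Hu1 & _ & _ & _ & Hu5); auto.
  { apply Rdiv_lt_0_compat; lra. }
  specialize (HB u Hu1).
  assert (INR (length l) * (d / (INR (length l) + 1)) < d)%R as H2.
  { replace (INR (length l) * (d / (INR (length l) + 1)))%R
      with (d * (INR (length l) / (INR (length l) + 1)))%R by (field; lra).
    rewrite <- (Rmult_1_r d) at 2. apply Rmult_lt_compat_l; [lra|].
    apply Rmult_lt_reg_r with (INR (length l) + 1)%R; [lra|].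
    unfold Rdiv. rewrite Rmult_assoc, Rinv_l; lra. }
  unfold d in *; lra.
Qed.

(** * Comparison with ordered series *)

Lemma hasSum_is_series (f : nat -> C) s :
  hasSum f s -> is_series (V := C_NormedModule) f s.
Proof.
  intros Hf. unfold is_series.
  apply (filterlim_locally_ball_norm (K := C_AbsRing) (U := C_NormedModule)).
  intros eps. destruct (Hf eps (cond_pos eps)) as [l0 Hl0].
  exists (list_max l0). intros n Hn.
  assert (sum_n f n = lsum f (seq 0 (S n))) as E.
  { clear. induction n as [|n IH].
    - rewrite sum_O. simpl. ring.
    - rewrite sum_Sn, IH. rewrite (seq_S (S n)). rewrite lsum_app. simpl.
      unfold plus; simpl. ring. }
  change (Cmod (Cminus (sum_n f n) s) < eps)%R. rewrite E.
  apply Hl0; [apply seq_NoDup|].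
  intros k Hk. apply in_seq.
  assert (k <= list_max l0)%nat; [|lia].
  assert (H := proj1 (list_max_le l0 (list_max l0)) (Nat.le_refl _)).
  rewrite Forall_forall in H. auto.
Qed.

(** Each half-line is a fibre of the bijection of $\{\pm\}\times\mathbf N$ with the integers;
    absolute convergence is what makes the two one-sided sums exist. *)
Lemma hasSum_bilateral (f : Z -> C) s :
  abs_bounded f -> hasSum f s -> is_bilateral_series f s.
Proof.
  intros Hb Hs.
  set (phi := fun p : bool * nat =>
    if fst p then Z.of_nat (snd p) else (- Z.of_nat (S (snd p)))%Z).
  assert (forall p p', phi p = phi p' -> p = p') as Hinj.
  { intros [[] n] [[] n']; cbv beta iota delta [phi fst snd]; intros H;
      try lia; f_equal; lia. }
  assert (hasSum (fun p => f (phi p)) s) as Hs'.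
  { apply hasSum_reindex; auto. intros z _.
    destruct (Z_lt_le_dec z 0).
    - exists (false, Z.to_nat (- z - 1)). cbv beta iota delta [phi fst snd]. lia.
    - exists (true, Z.to_nat z). cbv beta iota delta [phi fst snd]. lia. }
  apply (abs_bounded_inj phi) in Hb; auto.
  assert (forall b, exists t, hasSum (fun n => f (phi (b, n))) t) as Hfib.
  { intros b. apply abs_bounded_hasSum.
    apply (abs_bounded_inj (fun n : nat => (b, n)) (fun p => f (phi p))); auto.
    intros ? ? [=]; auto. }
  destruct (Hfib true) as [s1 H1]. destruct (Hfib false) as [s2 H2].
  exists s1, s2. split; [|split].
  - now apply hasSum_is_series.
  - now apply hasSum_is_series.
  - assert (hasSum (fun b : bool => if b then s1 else s2) s) as Hg.
    { apply hasSum_fiberwise with (fun p => f (phi p)); auto. intros []; auto. }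
    apply hasSum_unique with (1 := Hg). intros eps Heps.
    exists (true :: false :: nil). intros l Hnd Hi.
    replace (lsum (fun b : bool => if b then s1 else s2) l) with (s1 + s2).
    + replace (s1 + s2 - (s1 + s2)) with (RtoC 0) by ring. now rewrite Cmod_0.
    + assert (Permutation l (true :: false :: nil)) as HP.
      { apply NoDup_Permutation; auto.
        - repeat constructor; simpl; intuition discriminate.
        - intros b; split; [destruct b; simpl; auto|apply Hi]. }
      assert (forall l l', Permutation l l' ->
         lsum (fun b : bool => if b then s1 else s2) l
         = lsum (fun b : bool => if b then s1 else s2) l') as HPl.
      { clear. induction 1; simpl; try congruence. ring. }
      rewrite (HPl _ _ HP). simpl. ring.
Qed.

(** The form in which the series in the definition of the Hahn-Exton function is
    evaluated: a sum over all integers whose terms of negative index vanish. *)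
Lemma CSeries_hasSum (u : nat -> C) (f : Z -> C) s :
  (forall k, u k = f (Z.of_nat k)) -> (forall k, (k < 0)%Z -> f k = 0) ->
  hasSum f s -> CSeries u = s.
Proof.
  intros Hu Hneg Hs.
  assert (is_series (V := C_NormedModule) u s) as H.
  { apply (is_series_ext (V := C_NormedModule) (fun k => f (Z.of_nat k))); auto.
    apply hasSum_is_series. apply (hasSum_reindex Z.of_nat); auto.
    - intros j j'. apply Nat2Z.inj.
    - intros k Hk. exists (Z.to_nat k). apply Z2Nat.id.
      apply Z.nlt_ge. intros Hlt. auto. }
  unfold CSeries. apply (iota_filterlim_locally (V := C_CompleteNormedModule)). exact H.
Qed.

Lemma is_bilateral_series_ext (f g : Z -> C) s :
  (forall z, f z = g z) -> is_bilateral_series f s -> is_bilateral_series g s.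
Proof.
  intros Hfg (s1 & s2 & H1 & H2 & ->). exists s1, s2. split; [|split; [|reflexivity]].
  - eapply is_series_ext; [|exact H1]. intros n; apply Hfg.
  - eapply is_series_ext; [|exact H2]. intros n; apply Hfg.
Qed.

(** * Powers of q and signs *)

Local Notation zc n := (RtoC (IZR n)).

Definition sgn (n : Z) : C := if Z.even n then 1 else - (1).

Lemma sgn_add m n : sgn (m + n) = sgn m * sgn n.
Proof.
  unfold sgn. rewrite Z.even_add. destruct (Z.even m), (Z.even n); simpl; ring.
Qed.

Lemma sgn_opp n : sgn (- n) = sgn n.
Proof. unfold sgn. now rewrite Z.even_opp. Qed.

Lemma sgn_sqr n : sgn n * sgn n = 1.
Proof. unfold sgn. destruct (Z.even n); ring. Qed.

Lemma Cmod_sgn n : Cmod (sgn n) = 1%R.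
Proof. unfold sgn. destruct (Z.even n); [apply Cmod_1|apply Cmod_m1]. Qed.

Lemma sgn_nat n : sgn (Z.of_nat n) = RtoC ((-1) ^ n)%R.
Proof.
  induction n as [|n IH]; [reflexivity|].
  rewrite Nat2Z.inj_succ, <- Z.add_1_r, sgn_add, IH. simpl pow.
  rewrite RtoC_mult. unfold sgn at 1; simpl. ring.
Qed.

Lemma sgn_powerRZ n : sgn n = RtoC (powerRZ (-1) n).
Proof.
  destruct n as [|p|p]; [reflexivity| |].
  - rewrite <- (positive_nat_Z p), sgn_nat, <- pow_powerRZ. reflexivity.
  - change (Z.neg p) with (- Z.pos p)%Z.
    rewrite sgn_opp, powerRZ_neg', <- (positive_nat_Z p), sgn_nat, <- pow_powerRZ.
    f_equal. rewrite <- pow_inv. f_equal. lra.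
Qed.

Lemma Cexp_add a b : Cexp (a + b) = Cexp a * Cexp b.
Proof.
  destruct a as [a a'], b as [b b']. unfold Cexp, Cplus, Cmult, Re, Im; simpl.
  rewrite exp_plus, cos_plus, sin_plus. f_equal; ring.
Qed.

Lemma qpow_add q a b : qpow q (a + b) = qpow q a * qpow q b.
Proof. unfold qpow. rewrite <- Cexp_add. f_equal. ring. Qed.

Lemma qpow_RtoC q x : qpow q (RtoC x) = RtoC (Rpower q x).
Proof.
  unfold qpow. rewrite <- RtoC_mult. unfold Cexp, Rpower, RtoC, Re, Im; simpl.
  rewrite cos_0, sin_0. f_equal; ring.
Qed.

Lemma qpow_0 q : qpow q 0 = 1.
Proof. rewrite qpow_RtoC. unfold Rpower. now rewrite Rmult_0_l, exp_0. Qed.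

Lemma qpow_1 q : (0 < q)%R -> qpow q 1 = RtoC q.
Proof. intros Hq. rewrite qpow_RtoC. now rewrite Rpower_1. Qed.

Lemma qpow_nat q n : (0 < q)%R -> qpow q (RtoC (INR n)) = RtoC (q ^ n)%R.
Proof. intros Hq. rewrite qpow_RtoC. now rewrite Rpower_pow. Qed.

Lemma qpow_mult_nat q a n : qpow q a ^ n = qpow q (a * RtoC (INR n)).
Proof.
  induction n as [|n IH].
  - simpl. rewrite Cmult_0_r, qpow_0. reflexivity.
  - rewrite S_INR, RtoC_plus, Cpow_S, IH, <- qpow_add. f_equal. ring.
Qed.

Lemma Cmod_qpow q a : Cmod (qpow q a) = Rpower q (Re a).
Proof.
  unfold qpow, Rpower. rewrite <- re_scal_r. set (b := a * RtoC (ln q)).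
  unfold Cexp, Cmod, fst, snd.
  replace ((exp (Re b) * cos (Im b)) ^ 2 + (exp (Re b) * sin (Im b)) ^ 2)%R
    with (exp (Re b) * exp (Re b) * (Rsqr (sin (Im b)) + Rsqr (cos (Im b))))%R
    by (unfold Rsqr; ring).
  rewrite sin2_cos2, Rmult_1_r. apply sqrt_square. left; apply exp_pos.
Qed.

Lemma Rpower_pos q x : (0 < Rpower q x)%R.
Proof. apply exp_pos. Qed.

Lemma Rpower_antitone q x y : (0 < q < 1)%R -> (y <= x)%R -> (Rpower q x <= Rpower q y)%R.
Proof.
  intros Hq Hxy. unfold Rpower. assert (ln q < 0)%R.
  { rewrite <- ln_1. apply ln_increasing; lra. }
  destruct (Rle_lt_or_eq_dec _ _ Hxy) as [Hlt|Heq]; [|subst; lra].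
  left. apply exp_increasing. nra.
Qed.

Lemma qpow_neq_1 q x : (0 < q < 1)%R -> x <> 0%R -> 1 - qpow q (RtoC x) <> 0.
Proof.
  intros Hq Hx. rewrite qpow_RtoC, <- RtoC_minus. intros H. apply RtoC_inj in H.
  assert (ln q < 0)%R by (rewrite <- ln_1; apply ln_increasing; lra).
  assert (exp (x * ln q) = exp 0)%R as He by (rewrite exp_0; unfold Rpower in H; lra).
  apply exp_inv in He. nra.
Qed.

Ltac zcs := repeat (rewrite ?plus_IZR, ?minus_IZR, ?opp_IZR, ?mult_IZR, ?RtoC_plus,
                    ?RtoC_minus, ?RtoC_opp, ?RtoC_mult).

(** * Gaussian majorants *)

(** The factor $q^{n^2/2}$ beats every $q^{An}$, so this majorant is summable for all real
    $A$, and geometric factors merge into $A$. *)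
Definition gaussian (q A : R) (n : Z) : R :=
  if (n <? 0)%Z then 0%R else Rpower q (IZR n * IZR n / 2 + A * IZR n).

Lemma gaussian_nonneg q A n : (0 <= gaussian q A n)%R.
Proof. unfold gaussian. destruct (n <? 0)%Z; [lra|left; apply Rpower_pos]. Qed.

Lemma geometric_bounded q d : (0 < q < 1)%R -> (0 < d)%R ->
  exists B, sum_bounded (fun n : Z => Rpower q (d * Rabs (IZR n))) B.
Proof.
  intros Hq Hd. set (rho := Rpower q d).
  assert (0 < rho < 1)%R as Hrho.
  { split; [apply Rpower_pos|]. unfold rho, Rpower. rewrite <- exp_0.
    apply exp_increasing.
    assert (ln q < 0)%R by (rewrite <- ln_1; apply ln_increasing; lra). nra. }
  exists (2 / (1 - rho))%R. intros l Hnd.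
  assert (forall N, rsum (fun n : nat => rho ^ n)%R (seq 0 N) <= 1 / (1 - rho))%R as Hgeo.
  { intros N.
    assert (rsum (fun n : nat => rho ^ n)%R (seq 0 N) = (1 - rho ^ N) / (1 - rho))%R as ->.
    { induction N as [|N IH]; [simpl; field; lra|].
      rewrite seq_S, rsum_app, IH. simpl. field; lra. }
    apply Rmult_le_compat_r; [left; apply Rinv_0_lt_compat; lra|].
    pose proof (pow_lt rho N). lra. }
  set (N := S (list_max (map Z.abs_nat l))).
  apply Rle_trans with
    (rsum (fun n : Z => Rpower q (d * Rabs (IZR n)))
       (map Z.of_nat (seq 0 N) ++ map (fun n => - Z.of_nat n)%Z (seq 0 N))).
  - apply rsum_incl; auto.
    + intros i; left; apply Rpower_pos.
    + intros z Hz.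
      assert (Z.abs_nat z <= list_max (map Z.abs_nat l))%nat as Hle.
      { assert (H := proj1 (list_max_le (map Z.abs_nat l) _) (Nat.le_refl _)).
        rewrite Forall_forall in H. apply H. now apply in_map. }
      apply in_or_app. destruct (Z_lt_le_dec z 0); [right|left]; apply in_map_iff;
        exists (Z.abs_nat z); (split; [lia|apply in_seq; unfold N; lia]).
  - rewrite rsum_app, !rsum_map.
    assert (forall u : nat -> R, (forall n, Rabs (u n) = INR n) ->
      rsum (fun n => Rpower q (d * Rabs (u n))) (seq 0 N) <= 1 / (1 - rho))%R as Hu.
    { intros u Hu. eapply Rle_trans; [|apply (Hgeo N)]. apply rsum_le.
      intros n. rewrite Hu, <- Rpower_mult, Rpower_pow; [|apply Rpower_pos].
      fold rho. lra. }
    replace (2 / (1 - rho))%R with (1 / (1 - rho) + 1 / (1 - rho))%R by (field; lra).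
    apply Rplus_le_compat; apply (Hu (fun n => IZR _)); intros n.
    + rewrite <- INR_IZR_INZ. apply Rabs_pos_eq, pos_INR.
    + rewrite opp_IZR, Rabs_Ropp, <- INR_IZR_INZ. apply Rabs_pos_eq, pos_INR.
Qed.

(** Completing the square, $n^2/2+An\ge n-(A-1)^2/2$. *)
Lemma gaussian_bounded q A : (0 < q < 1)%R -> exists B, sum_bounded (gaussian q A) B.
Proof.
  intros Hq. destruct (geometric_bounded q 1 Hq) as [B HB]; [lra|].
  exists (Rpower q (- ((A - 1) * (A - 1) / 2)) * B)%R.
  apply sum_bounded_le with
    (fun n => Rpower q (- ((A - 1) * (A - 1) / 2)) * Rpower q (1 * Rabs (IZR n)))%R.
  - intros n. unfold gaussian. destruct (Z.ltb_spec n 0) as [Hn|Hn].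
    + apply Rmult_le_pos; left; apply Rpower_pos.
    + rewrite <- Rpower_plus. apply Rpower_antitone; auto.
      rewrite Rabs_pos_eq by (now apply IZR_le).
      pose proof (Rle_0_sqr (IZR n + (A - 1))). unfold Rsqr in *. lra.
  - apply sum_bounded_scal; auto. left; apply Rpower_pos.
Qed.

Lemma abs_bounded_gaussian q A c (f : Z -> C) :
  (0 < q < 1)%R -> (0 <= c)%R ->
  (forall n, Cmod (f n) <= c * gaussian q A n)%R -> abs_bounded f.
Proof.
  intros Hq Hc H. destruct (gaussian_bounded q A Hq) as [B HB].
  now apply abs_bounded_le with (gaussian q A) c B.
Qed.

(** * Reciprocal q-factorials and Euler's expansion *)

(** Vanishing at negative indices lets the recursion [rqfact_rec] hold on all of
    $\mathbf Z$. *)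
Definition rqfact (q : R) (n : Z) : C :=
  if (n <? 0)%Z then 0 else / qpoch q (RtoC q) (Z.to_nat n).

Lemma rqfact_neg q n : (n < 0)%Z -> rqfact q n = 0.
Proof. intros Hn. unfold rqfact. now rewrite (proj2 (Z.ltb_lt n 0)). Qed.

Lemma rqfact_0 q : rqfact q 0 = 1.
Proof. unfold rqfact; simpl. field. Qed.

Lemma rqfact_nat q n : rqfact q (Z.of_nat n) = / qpoch q (RtoC q) n.
Proof.
  unfold rqfact. rewrite Nat2Z.id. destruct (Z.ltb_spec (Z.of_nat n) 0); [lia|auto].
Qed.

Lemma qpoch_step_lower q n : (0 < q < 1)%R -> 
  (1 - q <= Cmod (1 - RtoC q * RtoC (q ^ n)))%R.
Proof.
  intros Hq. rewrite <- RtoC_mult, <- RtoC_minus, Cmod_R.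
  assert (0 < q ^ n)%R by (apply pow_lt; lra).
  assert (q ^ n <= 1)%R by (rewrite <- (pow1 n); apply pow_incr; lra).
  rewrite Rabs_pos_eq; nra.
Qed.

Lemma qpoch_q_lower q n : (0 < q < 1)%R -> ((1 - q) ^ n <= Cmod (qpoch q (RtoC q) n))%R.
Proof.
  intros Hq. induction n as [|n IH]; simpl.
  - rewrite Cmod_1; lra.
  - rewrite Cmod_mult, Rmult_comm. apply Rmult_le_compat; auto.
    + apply pow_le; lra.
    + lra.
    + now apply qpoch_step_lower.
Qed.

Lemma qpoch_q_neq_0 q n : (0 < q < 1)%R -> qpoch q (RtoC q) n <> 0.
Proof.
  intros Hq. apply Cmod_gt_0. pose proof (qpoch_q_lower q n Hq).
  assert (0 < (1 - q) ^ n)%R by (apply pow_lt; lra). lra.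
Qed.

Lemma rqfact_rec q n : (0 < q < 1)%R ->
  (1 - qpow q (zc n)) * rqfact q n = rqfact q (n - 1).
Proof.
  intros Hq. destruct (Z_lt_le_dec n 0) as [Hn|Hn].
  - rewrite !rqfact_neg by lia. ring.
  - destruct (Z.eq_dec n 0) as [->|Hn0].
    + rewrite qpow_0, (rqfact_neg q (0 - 1)) by lia. ring.
    + replace n with (Z.of_nat (S (Z.to_nat (n - 1)))) by lia.
      set (k := Z.to_nat (n - 1)).
      replace (Z.of_nat (S k) - 1)%Z with (Z.of_nat k) by lia.
      rewrite !rqfact_nat, <- INR_IZR_INZ, qpow_nat by lra.
      pose proof (qpoch_q_neq_0 q (S k) Hq) as Hne. simpl in *.
      rewrite RtoC_mult. field. split.
      * now apply qpoch_q_neq_0.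
      * intros H. apply Hne. rewrite H. ring.
Qed.

(** The crude bound $1/(1-q)^n$, written as a power of q so that it merges with the
    Gaussian majorants. *)
Lemma rqfact_crude_bound q : (0 < q < 1)%R ->
  exists kappa, forall n, (0 <= n)%Z -> (Cmod (rqfact q n) <= Rpower q (kappa * IZR n))%R.
Proof.
  intros Hq.
  assert (ln q < 0)%R as Hlnq by (rewrite <- ln_1; apply ln_increasing; lra).
  exists (- ln (1 - q) / ln q)%R. intros n Hn.
  rewrite <- (Z2Nat.id n Hn), rqfact_nat. set (k := Z.to_nat n).
  rewrite Cmod_inv by now apply qpoch_q_neq_0.
  replace (Rpower q (- ln (1 - q) / ln q * IZR (Z.of_nat k))) with (/ (1 - q) ^ k)%R.
  - apply Rinv_le_contravar; [apply pow_lt; lra|now apply qpoch_q_lower].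
  - rewrite <- INR_IZR_INZ, <- (Rpower_pow k (1 - q)) by lra.
    rewrite <- Rpower_Ropp. unfold Rpower. f_equal. field. lra.
Qed.

Definition euler_term (q : R) (a : C) (l : Z) : C :=
  sgn l * qpow q (zc l * (zc l - 1) / 2 + a * zc l) * rqfact q l.

Lemma Re_half (a : C) : Re (a / 2) = (Re a / 2)%R.
Proof. destruct a. unfold Re, Cdiv, Cinv, Cmult; simpl. field. Qed.

Lemma Cmod_euler_term_le q A : (0 < q < 1)%R -> exists A', forall a l,
  (A <= Re a)%R -> (Cmod (euler_term q a l) <= gaussian q A' l)%R.
Proof.
  intros Hq. destruct (rqfact_crude_bound q Hq) as [kappa Hk].
  exists (A - 1 / 2 + kappa)%R. intros a l Ha. unfold euler_term, gaussian.
  rewrite !Cmod_mult, Cmod_sgn, Cmod_qpow.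
  destruct (Z.ltb_spec l 0) as [Hl|Hl].
  - rewrite rqfact_neg, Cmod_0 by auto. lra.
  - apply Rle_trans with (1 * Rpower q (IZR l * (IZR l - 1) / 2 + A * IZR l)
                          * Rpower q (kappa * IZR l))%R.
    + apply Rmult_le_compat; [|apply Cmod_ge_0| |auto].
      * rewrite Rmult_1_l. left; apply Rpower_pos.
      * rewrite !Rmult_1_l. apply Rpower_antitone; auto.
        rewrite re_plus, Re_half, re_scal_r, <- RtoC_minus, re_scal_l, re_RtoC.
        apply Rplus_le_compat_l. apply Rmult_le_compat_r; auto. now apply IZR_le.
    + rewrite Rmult_1_l, <- Rpower_plus. right. f_equal. field.
Qed.

Lemma euler_term_hasSum q a : (0 < q < 1)%R -> exists s, hasSum (euler_term q a) s.
Proof.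
  intros Hq. destruct (Cmod_euler_term_le q (Re a) Hq) as [A' HA'].
  apply abs_bounded_hasSum. apply abs_bounded_gaussian with q A' 1%R; auto; [lra|].
  intros n. rewrite Rmult_1_l. apply HA'. lra.
Qed.

Lemma hasSum_shift (f : Z -> C) d s : hasSum f s -> hasSum (fun n => f (n + d)%Z) s.
Proof.
  intros H. apply (hasSum_reindex (fun n => n + d)%Z f); auto.
  - intros; lia.
  - intros i _. exists (i - d)%Z. lia.
Qed.

(** The coefficient recursion turns the difference of two consecutive sums into a shift. *)
Lemma euler_sum_rec q a s s' : (0 < q < 1)%R ->
  hasSum (euler_term q a) s -> hasSum (euler_term q (a + 1)) s' ->
  s = (1 - qpow q a) * s'.
Proof.
  intros Hq Hs Hs'.
  assert (hasSum (euler_term q a) (s' + (- qpow q a) * s')) as H.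
  { apply hasSum_ext with (fun l => euler_term q (a + 1) l
                                    + (- qpow q a) * euler_term q (a + 1) (l + -1)).
    - intros l. unfold euler_term.
      replace (l + -1)%Z with (l - 1)%Z by lia. rewrite <- rqfact_rec by auto.
      replace (sgn (l - 1)) with (- sgn l)
        by (unfold Z.sub; rewrite sgn_add; change (sgn (- (1))) with (- (1)); ring).
      set (e := zc (l - 1) * (zc (l - 1) - 1) / 2 + (a + 1) * zc (l - 1)).
      replace (zc l * (zc l - 1) / 2 + (a + 1) * zc l) with (a + e + zc l)
        by (unfold e; zcs; field).
      replace (zc l * (zc l - 1) / 2 + a * zc l) with (a + e) by (unfold e; zcs; field).
      rewrite !qpow_add. ring.
    - apply hasSum_plus; auto. apply hasSum_scal. now apply hasSum_shift. }
  rewrite (hasSum_unique _ _ _ Hs H). ring.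
Qed.

Lemma euler_sum_qpoch q a s n : (0 < q < 1)%R -> hasSum (euler_term q a) s ->
  exists s', hasSum (euler_term q (a + RtoC (INR n))) s' /\
             s = qpoch q (qpow q a) n * s'.
Proof.
  intros Hq Hs. induction n as [|n (s' & H1 & H2)].
  - exists s. rewrite Cplus_0_r. split; auto. simpl. ring.
  - destruct (euler_term_hasSum q (a + RtoC (INR (S n))) Hq) as [s'' Hs''].
    exists s''. split; auto.
    rewrite H2. rewrite S_INR, RtoC_plus, Cplus_assoc in Hs''.
    rewrite (euler_sum_rec q _ s' s'' Hq H1 Hs''). simpl.
    rewrite qpow_add, qpow_nat by lra. ring.
Qed.

(** With $E$ the sum of Euler's series, $E(a)-1$ is the sum of the terms with $l\ge1$, each
    of which carries a factor $q^{al}$, at most $q^{\Re a}$ in modulus. *)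
Lemma euler_sum_near_1 q : (0 < q < 1)%R -> exists B, (0 <= B)%R /\ forall a s,
  (0 <= Re a)%R -> hasSum (euler_term q a) s -> (Cmod (s - 1) <= B * Rpower q (Re a))%R.
Proof.
  intros Hq. destruct (Cmod_euler_term_le q 0 Hq) as [A' HA'].
  destruct (gaussian_bounded q A' Hq) as [B HB].
  exists B. split.
  { apply Rle_trans with (rsum (gaussian q A') nil); [simpl; lra|]. apply HB. constructor. }
  intros a s Ha Hs. rewrite Rmult_comm.
  set (delta := fun l : Z => if (l =? 0)%Z then RtoC 1 else 0).
  apply hasSum_norm_le with (fun l => euler_term q a l + (-1) * delta l).
  - replace (s - 1) with (s + (-1) * delta 0%Z) by (unfold delta; simpl; ring).
    apply hasSum_plus; auto. apply hasSum_scal. apply hasSum_single.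
    intros l Hl. unfold delta. destruct (Z.eqb_spec l 0); tauto.
  - apply sum_bounded_le with (fun l => Rpower q (Re a) * gaussian q A' l)%R;
      [|apply sum_bounded_scal; auto; left; apply Rpower_pos].
    intros l. unfold delta. destruct (Z.eqb_spec l 0) as [->|Hl].
    + unfold euler_term. rewrite rqfact_0.
      replace (0 * (0 - 1) / 2 + a * 0) with (RtoC 0) by field.
      rewrite qpow_0. change (sgn 0) with (RtoC 1).
      replace (1 * 1 * 1 + -1 * 1) with (RtoC 0) by ring. rewrite Cmod_0.
      apply Rmult_le_pos; [left; apply Rpower_pos|apply gaussian_nonneg].
    + replace (euler_term q a l + -1 * 0) with (euler_term q a l) by ring.
      destruct (Z_lt_le_dec l 0) as [Hl0|Hl0].
      * unfold euler_term. rewrite rqfact_neg, Cmult_0_r, Cmod_0 by auto.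
        apply Rmult_le_pos; [left; apply Rpower_pos|apply gaussian_nonneg].
      * replace (euler_term q a l)
          with (qpow q (a * zc l) * euler_term q 0 l).
        2:{ unfold euler_term. rewrite !qpow_add.
            replace (0 * zc l) with (RtoC 0) by ring. rewrite qpow_0. ring. }
        rewrite Cmod_mult. apply Rmult_le_compat; try apply Cmod_ge_0.
        -- rewrite Cmod_qpow, re_scal_r. apply Rpower_antitone; auto.
           rewrite <- (Rmult_1_r (Re a)) at 1. apply Rmult_le_compat_l; auto.
           apply IZR_le. lia.
        -- apply HA'. simpl. lra.
Qed.

Definition qfac (q : R) (a : C) : C := qpoch_inf q (qpow q a).

Lemma Rpower_lim_0 q A eps : (0 < q < 1)%R -> (0 < eps)%R ->
  exists N : nat, forall n, (N <= n)%nat -> (Rpower q (A + INR n) < eps)%R.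
Proof.
  intros Hq Heps. destruct (pow_lt_1_zero q (Rabs_def1 _ _ (proj2 Hq) ltac:(lra)) (eps / Rpower q A))
    as [N HN].
  { apply Rdiv_lt_0_compat; auto. apply Rpower_pos. }
  exists N. intros n Hn. specialize (HN n Hn).
  rewrite Rabs_pos_eq in HN by (apply pow_le; lra).
  rewrite Rpower_plus, Rpower_pow by lra.
  apply (Rmult_lt_compat_l (Rpower q A)) in HN; [|apply Rpower_pos].
  replace (Rpower q A * (eps / Rpower q A))%R with eps in HN; auto.
  field. apply Rgt_not_eq, Rpower_pos.
Qed.

(** Euler's series $E(a)=\sum_l (-1)^l q^{l(l-1)/2+al}/(q;q)_l$ satisfies
    $E(a)=(q^a;q)_n\,E(a+n)$ with $E(a+n)\to1$, so the infinite product converges to it. *)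
Lemma euler q a : (0 < q < 1)%R -> hasSum (euler_term q a) (qfac q a).
Proof.
  intros Hq. destruct (euler_term_hasSum q a Hq) as [s Hs].
  replace (qfac q a) with s; auto. symmetry.
  apply (iota_filterlim_locally (V := C_CompleteNormedModule)).
  apply (filterlim_locally_ball_norm (K := C_AbsRing) (U := C_NormedModule)).
  intros eps. destruct (euler_sum_near_1 q Hq) as (B & HB & Hnear).
  pose proof (cond_pos eps) as Heps. pose proof (Cmod_ge_0 s) as Hs0.
  (* With $s'=E(a+n)$: $|s'-1|\le1/2$ gives $|(q^a;q)_n|\le2|s|$, and the other bound on
     $|s'-1|$ then makes $|(q^a;q)_n(1-s')|$ small. *)
  set (eta := Rmin (1 / 2) (eps / (4 * (Cmod s + 1)))%R).
  assert (0 < eta)%R as Heta.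
  { apply Rmin_pos; [lra|]. apply Rdiv_lt_0_compat; lra. }
  destruct (Rpower_lim_0 q (Re a) (eta / (B + 1)) Hq) as [N1 HN1].
  { apply Rdiv_lt_0_compat; lra. }
  destruct (INR_unbounded (- Re a)) as [N2 HN2].
  exists (N1 + N2)%nat. intros n Hn.
  change (Cmod (Cminus (qpoch q (qpow q a) n) s) < eps)%R.
  destruct (euler_sum_qpoch q a s n Hq Hs) as (s' & Hs' & E).
  assert (INR N2 <= INR n)%R by (apply le_INR; lia).
  assert (Cmod (s' - 1) < eta)%R as Hlt.
  { apply Hnear in Hs'; rewrite re_plus, re_RtoC in *; [|lra].
    assert (Rpower q (Re a + INR n) < eta / (B + 1))%R as Hp by (apply HN1; lia).
    apply (Rmult_lt_compat_l (B + 1)) in Hp; [|lra].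
    replace ((B + 1) * (eta / (B + 1)))%R with eta in Hp by (field; lra).
    pose proof (Rpower_pos q (Re a + INR n)). lra. }
  set (p := qpoch q (qpow q a) n) in *.
  assert (Cmod p <= 2 * Cmod s)%R as Hp.
  { rewrite E, Cmod_mult.
    assert (1 <= Cmod (s' - 1) + Cmod s')%R.
    { pose proof (Cmod_triangle (- (s' - 1)) s') as Ht.
      replace (- (s' - 1) + s') with (RtoC 1) in Ht by ring.
      now rewrite Cmod_opp, Cmod_1 in Ht. }
    pose proof (Rmin_l (1 / 2) (eps / (4 * (Cmod s + 1)))). fold eta in H1.
    pose proof (Cmod_ge_0 p). nra. }
  rewrite E. replace (p - p * s') with (- (p * (s' - 1))) by ring.
  rewrite Cmod_opp, Cmod_mult.
  pose proof (Rmin_r (1 / 2) (eps / (4 * (Cmod s + 1)))) as He. fold eta in He.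
  assert (eta * (4 * (Cmod s + 1)) <= eps)%R as He'.
  { apply (Rmult_le_compat_r (4 * (Cmod s + 1))) in He; [|lra].
    replace (eps / (4 * (Cmod s + 1)) * (4 * (Cmod s + 1)))%R with (pos eps) in He; auto.
    field. lra. }
  pose proof (Cmod_ge_0 (s' - 1)). pose proof (Cmod_ge_0 p). nra.
Qed.

Lemma qfac_rec q a : (0 < q < 1)%R -> qfac q a = (1 - qpow q a) * qfac q (a + 1).
Proof. intros Hq. apply euler_sum_rec; auto using euler. Qed.

Lemma qfac_qpoch q a n : (0 < q < 1)%R ->
  qfac q a = qpoch q (qpow q a) n * qfac q (a + RtoC (INR n)).
Proof.
  intros Hq. destruct (euler_sum_qpoch q a _ n Hq (euler q a Hq)) as (s' & H1 & ->).
  f_equal. apply hasSum_unique with (1 := H1). now apply euler.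
Qed.

(** At $a=0$ the recursion has the factor $1-q^0=0$, and this zero propagates downwards. *)
Lemma qfac_neg q n : (0 < q < 1)%R -> (n <= 0)%Z -> qfac q (zc n) = 0.
Proof.
  intros Hq Hn. replace n with (- Z.of_nat (Z.to_nat (- n)))%Z by lia.
  generalize (Z.to_nat (- n)). intros k. induction k as [|k IH].
  - rewrite qfac_rec by auto. simpl. rewrite qpow_0. ring.
  - rewrite qfac_rec by auto.
    replace (zc (- Z.of_nat (S k)) + 1) with (zc (- Z.of_nat k)).
    + rewrite IH. ring.
    + rewrite Nat2Z.inj_succ, <- Z.add_1_r. zcs. ring.
Qed.

(** If it vanished, so would all $(q^{n+1};q)_\infty$, since $(q;q)_n\ne0$; but these tend
    to 1. *)
Lemma qfac_1_neq_0 q : (0 < q < 1)%R -> qfac q 1 <> 0.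
Proof.
  intros Hq H0. destruct (euler_sum_near_1 q Hq) as (B & HB & Hnear).
  destruct (Rpower_lim_0 q 1 (1 / (B + 1)) Hq) as [N HN].
  { apply Rdiv_lt_0_compat; lra. }
  specialize (HN N (Nat.le_refl _)).
  assert (qfac q (1 + RtoC (INR N)) = 0) as HN0.
  { rewrite (qfac_qpoch q 1 N Hq), qpow_1 in H0 by lra.
    destruct (classic (qfac q (1 + RtoC (INR N)) = 0)) as [|Hne]; auto.
    exfalso. apply (Cmult_neq_0 _ _ (qpoch_q_neq_0 q N Hq) Hne H0). }
  pose proof (euler q (1 + RtoC (INR N)) Hq) as He. rewrite HN0 in He.
  apply Hnear in He; rewrite re_plus, !re_RtoC in *; [|pose proof (pos_INR N); lra].
  replace (0 - 1) with (- (1)) in He by ring. rewrite Cmod_m1 in He.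
  apply (Rmult_lt_compat_l (B + 1)) in HN; [|lra].
  replace ((B + 1) * (1 / (B + 1)))%R with 1%R in HN by (field; lra).
  pose proof (Rpower_pos q (1 + INR N)). lra.
Qed.

(** * Reciprocal q-gamma coefficients *)

(** Up to the power $(1-q)^b$, this is $1/\Gamma_q(b+1)$. *)
Definition rqgam (q : R) (b : C) : C := qfac q (b + 1) / qfac q 1.

Lemma rqgam_int q n : (0 < q < 1)%R -> rqgam q (zc n) = rqfact q n.
Proof.
  intros Hq. pose proof (qfac_1_neq_0 q Hq) as H1. unfold rqgam.
  destruct (Z_lt_le_dec n 0) as [Hn|Hn].
  - rewrite rqfact_neg by auto. rewrite <- RtoC_plus, <- plus_IZR, qfac_neg by (auto; lia).
    field. auto.
  - rewrite <- (Z2Nat.id n Hn), rqfact_nat. set (k := Z.to_nat n).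
    rewrite <- INR_IZR_INZ.
    rewrite (qfac_qpoch q 1 k Hq), qpow_1 by lra.
    rewrite (qfac_qpoch q 1 k Hq), qpow_1 in H1 by lra.
    replace (RtoC (INR k) + 1) with (1 + RtoC (INR k)) by ring.
    field. split.
    + now apply qpoch_q_neq_0.
    + intros H. apply H1. rewrite H. ring.
Qed.

Lemma rqgam_rec q b : (0 < q < 1)%R -> rqgam q (b - 1) = (1 - qpow q b) * rqgam q b.
Proof.
  intros Hq. unfold rqgam. rewrite (qfac_rec q (b - 1 + 1)) by auto.
  replace (b - 1 + 1) with b by ring. unfold Cdiv. ring.
Qed.

(** Euler's series is dominated uniformly on the half-plane. *)
Lemma rqgam_bounded q A : (0 < q < 1)%R ->
  exists G, (0 <= G)%R /\ forall b, (A <= Re b)%R -> (Cmod (rqgam q b) <= G)%R.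
Proof.
  intros Hq. destruct (Cmod_euler_term_le q (A + 1) Hq) as [A' HA'].
  destruct (gaussian_bounded q A' Hq) as [B HB].
  pose proof (qfac_1_neq_0 q Hq) as H1. apply Cmod_gt_0 in H1 as H1'.
  assert (forall b, (A <= Re b)%R -> (Cmod (qfac q (b + 1)) <= B)%R) as Hb.
  { intros b Hb. apply hasSum_norm_le with (euler_term q (b + 1)); [now apply euler|].
    apply sum_bounded_le with (gaussian q A'); auto.
    intros l. apply HA'. rewrite re_plus, re_RtoC. lra. }
  exists (B / Cmod (qfac q 1))%R. split.
  - apply Rmult_le_pos; [|left; now apply Rinv_0_lt_compat].
    apply Rle_trans with (Cmod (qfac q (RtoC A + 1))); [apply Cmod_ge_0|].
    apply Hb. rewrite re_RtoC. lra.
  - intros b H. unfold rqgam. rewrite Cmod_div by auto.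
    apply Rmult_le_compat_r; [left; now apply Rinv_0_lt_compat|auto].
Qed.

Lemma rqfact_bounded q : (0 < q < 1)%R ->
  exists H, (0 <= H)%R /\ forall n, (Cmod (rqfact q n) <= H)%R.
Proof.
  intros Hq. destruct (rqgam_bounded q 0 Hq) as (G & HG & Hb). exists G. split; auto.
  intros n. destruct (Z_lt_le_dec n 0) as [Hn|Hn].
  - rewrite rqfact_neg, Cmod_0; auto.
  - rewrite <- rqgam_int by auto. apply Hb. rewrite re_RtoC. now apply IZR_le.
Qed.

(** * The Hahn-Exton function as a sum over the integers *)

(** The $k$-th term of $J_\alpha(q^{a/2};q)$, including the prefactor $q^{a\alpha/2}$. *)
Definition he_term (q : R) (al a : C) (k : Z) : C :=
  sgn k * qpow q (zc k * (zc k + 1) / 2 + a * zc k + a * al / 2)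
  * rqfact q k * rqgam q (al + zc k).

Definition heJ (q : R) (al a : C) : C := hahn_exton_q q al (a / 2).

Lemma triangle_nat k : INR (k * (k + 1) / 2) = (INR k * (INR k + 1) / 2)%R.
Proof.
  assert (2 * (k * (k + 1) / 2) = k * (k + 1))%nat as H.
  { assert (exists t, k * (k + 1) = 2 * t)%nat as [t ->].
    { induction k as [|k [t IH]]; [exists 0%nat; lia|]. exists (t + (k + 1))%nat. lia. }
    rewrite (Nat.mul_comm 2 t), Nat.div_mul; lia. }
  apply (f_equal INR) in H. rewrite !mult_INR, plus_INR, INR_1 in H.
  change (INR 2) with (1 + 1)%R in H. lra.
Qed.

Lemma heJ_eq q al a : (0 < q < 1)%R ->
  forall s, hasSum (he_term q al a) s -> heJ q al a = s.
Proof.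
  intros Hq s Hs. unfold heJ, hahn_exton_q, hahn_exton.
  set (c := qpow q (a / 2 * al)).
  assert (c * qpow q (- (a / 2 * al)) = 1) as Hc.
  { unfold c. rewrite <- qpow_add, Cplus_opp_r. apply qpow_0. }
  rewrite (CSeries_hasSum _ (fun k => qpow q (- (a / 2 * al)) * he_term q al a k)
             (qpow q (- (a / 2 * al)) * s)).
  - rewrite Cmult_assoc, Hc. ring.
  - intros k. unfold he_term. rewrite rqfact_nat, sgn_nat. unfold rqgam, qfac.
    rewrite qpow_1, <- !INR_IZR_INZ, qpow_mult_nat, mult_INR by lra. simpl (INR 2).
    rewrite (RtoC_mult ((-1) ^ k)), <- (qpow_nat q), triangle_nat by lra.
    replace (qpow q (RtoC (INR k) * (RtoC (INR k) + 1) / 2 + a * RtoC (INR k) + a * al / 2))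
      with (qpow q (RtoC (INR k * (INR k + 1) / 2)) * qpow q (a / 2 * RtoC ((1 + 1) * INR k))
            * c).
    + transitivity (c * qpow q (- (a / 2 * al)) *
        (qpoch_inf q (qpow q (al + RtoC (INR k) + 1)) / qpoch_inf q (RtoC q) *
         (RtoC ((-1) ^ k) * qpow q (RtoC (INR k * (INR k + 1) / 2)) / qpoch q (RtoC q) k) *
         qpow q (a / 2 * RtoC ((1 + 1) * INR k)))).
      * rewrite Hc. ring.
      * unfold Cdiv. ring.
    + unfold c. rewrite <- !qpow_add. f_equal.
      rewrite RtoC_div, !RtoC_mult, !RtoC_plus by lra. field.
  - intros k Hk. unfold he_term. rewrite rqfact_neg by auto. ring.
  - now apply hasSum_scal.
Qed.

(** The double family obtained from [he_term] by Euler's expansion of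
    $(q^{\alpha+k+1};q)_\infty$; its exponent is symmetric under exchanging $(\alpha,l)$
    with $(a,k)$. *)
Definition sym_term (q : R) (al a : C) (p : Z * Z) : C :=
  sgn (fst p) * sgn (snd p)
  * qpow q (zc (fst p) * (zc (fst p) + 1) / 2 + zc (snd p) * (zc (snd p) + 1) / 2
            + zc (fst p) * zc (snd p) + a * zc (fst p) + al * zc (snd p) + a * al / 2)
  * rqfact q (fst p) * rqfact q (snd p) / qfac q 1.

Lemma sym_term_fiber q al a k : (0 < q < 1)%R ->
  hasSum (fun l => sym_term q al a (k, l)) (he_term q al a k).
Proof.
  intros Hq.
  set (c := sgn k * qpow q (zc k * (zc k + 1) / 2 + a * zc k + a * al / 2)
            * rqfact q k / qfac q 1).
  replace (he_term q al a k) with (c * qfac q (al + zc k + 1))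
    by (unfold c, he_term, rqgam, Cdiv; ring).
  apply hasSum_ext with (fun l => c * euler_term q (al + zc k + 1) l).
  - intros l. unfold c, euler_term, sym_term; simpl fst; simpl snd.
    replace (zc k * (zc k + 1) / 2 + zc l * (zc l + 1) / 2
            + zc k * zc l + a * zc k + al * zc l + a * al / 2)
      with ((zc k * (zc k + 1) / 2 + a * zc k + a * al / 2)
            + (zc l * (zc l - 1) / 2 + (al + zc k + 1) * zc l)) by field.
    rewrite (qpow_add q (_ + _ + _) (_ + _)). unfold Cdiv. ring.
  - apply hasSum_scal. now apply euler.
Qed.

Lemma sym_term_swap q al a k l : sym_term q al a (k, l) = sym_term q a al (l, k).
Proof.
  unfold sym_term; simpl fst; simpl snd.
  replace (zc l * (zc l + 1) / 2 + zc k * (zc k + 1) / 2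
            + zc l * zc k + al * zc l + a * zc k + al * a / 2)
    with (zc k * (zc k + 1) / 2 + zc l * (zc l + 1) / 2
            + zc k * zc l + a * zc k + al * zc l + a * al / 2) by field.
  unfold Cdiv. ring.
Qed.

Lemma Re_tri (n : Z) : Re (zc n * (zc n + 1) / 2) = (IZR n * (IZR n + 1) / 2)%R.
Proof. rewrite Re_half, <- RtoC_plus, <- RtoC_mult. reflexivity. Qed.

(** On the support $k,l\ge0$ the mixed exponent $kl$ only helps, so a product of two
    Gaussians dominates. *)
Lemma sym_term_bounded q al a : (0 < q < 1)%R -> abs_bounded (sym_term q al a).
Proof.
  intros Hq. destruct (rqfact_bounded q Hq) as (H & HH & Hb).
  destruct (gaussian_bounded q (1 / 2 + Re a) Hq) as [B1 HB1].
  destruct (gaussian_bounded q (1 / 2 + Re al) Hq) as [B2 HB2].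
  set (c := (H * H * Rpower q (Re (a * al / 2)) / Cmod (qfac q 1))%R).
  assert (0 < Cmod (qfac q 1))%R as Hpos by (apply Cmod_gt_0; now apply qfac_1_neq_0).
  assert (0 <= c)%R as Hc.
  { repeat apply Rmult_le_pos; auto; [left; apply Rpower_pos|].
    left; now apply Rinv_0_lt_compat. }
  eapply abs_bounded_le with (c := c);
    [auto|apply sum_bounded_prod; [| |exact HB1|exact HB2]; apply gaussian_nonneg|].
  intros [k l]. unfold sym_term, gaussian. simpl fst; simpl snd.
  destruct (Z.ltb_spec k 0) as [Hk|Hk].
  { rewrite (rqfact_neg q k) by auto. unfold Cdiv.
    rewrite Cmult_0_r, !Cmult_0_l, Cmod_0. lra. }
  destruct (Z.ltb_spec l 0) as [Hl|Hl].
  { rewrite (rqfact_neg q l) by auto. unfold Cdiv.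
    rewrite Cmult_0_r, !Cmult_0_l, Cmod_0. lra. }
  rewrite Cmod_div by now apply qfac_1_neq_0.
  rewrite !Cmod_mult, !Cmod_sgn, Cmod_qpow.
  set (g1 := Rpower q (IZR k * IZR k / 2 + _)). set (g2 := Rpower q (IZR l * IZR l / 2 + _)).
  set (E := zc k * (zc k + 1) / 2 + _ + _ + _ + _ + _).
  assert (Rpower q (Re E) <= Rpower q (Re (a * al / 2)) * (g1 * g2))%R as He.
  { unfold g1, g2, E. rewrite <- !Rpower_plus. apply Rpower_antitone; auto.
    rewrite !re_plus, !Re_tri, !re_scal_r, !re_RtoC.
    assert (0 <= IZR k * IZR l)%R by (apply Rmult_le_pos; now apply IZR_le).
    lra. }
  replace (c * (g1 * g2))%R
    with (H * H * (Rpower q (Re (a * al / 2)) * (g1 * g2)) / Cmod (qfac q 1))%R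
    by (unfold c, Rdiv; ring).
  apply Rmult_le_compat_r; [left; now apply Rinv_0_lt_compat|].
  replace (1 * 1 * Rpower q (Re E) * Cmod (rqfact q k) * Cmod (rqfact q l))%R
    with (Cmod (rqfact q k) * Cmod (rqfact q l) * Rpower q (Re E))%R by ring.
  apply Rmult_le_compat; auto.
  - apply Rmult_le_pos; apply Cmod_ge_0.
  - left; apply Rpower_pos.
  - apply Rmult_le_compat; auto using Cmod_ge_0.
Qed.

Lemma he_term_hasSum_sym q al a : (0 < q < 1)%R ->
  exists s, hasSum (he_term q al a) s /\ hasSum (he_term q a al) s.
Proof.
  intros Hq. destruct (abs_bounded_hasSum _ (sym_term_bounded q al a Hq)) as [s Hs].
  exists s. split.
  - apply hasSum_fiberwise with (1 := Hs). intros k. now apply sym_term_fiber.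
  - apply hasSum_fiberwise with (sym_term q a al); [|intros k; now apply sym_term_fiber].
    apply hasSum_ext with (fun p => sym_term q al a (snd p, fst p)).
    + intros [l k]. simpl. apply sym_term_swap.
    + apply (hasSum_reindex (fun p : Z * Z => (snd p, fst p))); auto.
      * intros [l k] [l' k'] [=]; simpl in *; congruence.
      * intros [k l] _. exists (l, k). reflexivity.
Qed.

Lemma heJ_hasSum q al a : (0 < q < 1)%R -> hasSum (he_term q al a) (heJ q al a).
Proof.
  intros Hq. destruct (he_term_hasSum_sym q al a Hq) as (s & Hs & _).
  now rewrite (heJ_eq q al a Hq s Hs).
Qed.

(** For integral $a$ this exchanges the order with the argument, replacing
    $J_x(q^{n/2};q)$ by a series with coefficients $1/(q;q)_{n+k}$. *)
Lemma heJ_sym q al a : (0 < q < 1)%R -> heJ q al a = heJ q a al.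
Proof.
  intros Hq. destruct (he_term_hasSum_sym q al a Hq) as (s & Hs & Hs').
  now rewrite (heJ_eq q al a Hq s Hs), (heJ_eq q a al Hq s Hs').
Qed.

(** * A terminating q-binomial sum *)

(** With $w=q^{-b}$ these are the terms of the finite q-binomial theorem
    $\sum_i (-1)^i q^{i(i-1)/2}w^i/((q;q)_i(q;q)_{n-i})=(w;q)_n/(q;q)_n$, multiplied by
    $g(b)$.  The product $g(b)\,(q^{-b};q)_n$ is the shifted value $g(b-n)$ up to a sign and
    a power of $q$, which gives [gauss_sum]. *)
Definition gauss_term (q : R) (b : C) (n i : Z) : C :=
  sgn i * qpow q (zc i * (zc i - 1) / 2 - b * zc i)
  * rqfact q i * rqfact q (n - i) * rqgam q b.

Definition gauss_sum (q : R) (b : C) (n : Z) : C :=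
  sgn n * qpow q (zc n * (zc n - 1) / 2 - b * zc n) * rqfact q n * rqgam q (b - zc n).

(** The q-Pascal rule, from $1-q^{n+1}=(1-q^{n+1-i})+q^{n+1-i}(1-q^i)$. *)
Lemma gauss_term_rec q b n i : (0 < q < 1)%R ->
  (1 - qpow q (zc (n + 1))) * gauss_term q b (n + 1) i
  = gauss_term q b n i + (- qpow q (zc n - b)) * gauss_term q b n (i - 1).
Proof.
  intros Hq. unfold gauss_term.
  replace (n - (i - 1))%Z with (n + 1 - i)%Z by lia.
  replace (n - i)%Z with (n + 1 - i - 1)%Z by lia.
  rewrite <- (rqfact_rec q (n + 1 - i)), <- (rqfact_rec q i) by auto.
  replace (sgn (i - 1)) with (- sgn i)
    by (unfold Z.sub; rewrite sgn_add; change (sgn (- (1))) with (- (1)); ring).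
  set (e := zc (i - 1) * (zc (i - 1) - 1) / 2 - b * zc (i - 1)).
  replace (zc i * (zc i - 1) / 2 - b * zc i) with (e + (zc i - 1 - b))
    by (unfold e; zcs; field).
  replace (qpow q (zc n - b)) with (qpow q (zc i - 1 - b) * qpow q (zc (n + 1 - i)))
    by (rewrite <- qpow_add; f_equal; zcs; ring).
  replace (zc (n + 1)) with (zc i + zc (n + 1 - i)) by (zcs; ring).
  rewrite !qpow_add. ring.
Qed.

Lemma gauss_sum_rec q b n : (0 < q < 1)%R ->
  (1 - qpow q (zc (n + 1))) * gauss_sum q b (n + 1)
  = (1 - qpow q (zc n - b)) * gauss_sum q b n.
Proof.
  intros Hq. unfold gauss_sum.
  replace (b - zc (n + 1)) with (b - zc n - 1) by (zcs; ring).
  rewrite rqgam_rec by auto.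
  replace (rqfact q n) with (rqfact q (n + 1 - 1)) by (f_equal; lia).
  rewrite <- rqfact_rec by auto. rewrite sgn_add. change (sgn 1) with (- (1)).
  replace (zc (n + 1) * (zc (n + 1) - 1) / 2 - b * zc (n + 1))
    with (zc n * (zc n - 1) / 2 - b * zc n + (zc n - b)) by (zcs; field).
  assert (qpow q (zc n - b) * qpow q (b - zc n) = 1) as E.
  { rewrite <- qpow_add. replace (zc n - b + (b - zc n)) with (RtoC 0) by ring.
    apply qpow_0. }
  set (Q := qpow q (zc n - b)) in *. set (Q' := qpow q (b - zc n)) in *.
  set (P := qpow q (zc n * (zc n - 1) / 2 - b * zc n + (zc n - b))).
  transitivity (sgn n * P * ((1 - qpow q (zc (n + 1))) * rqfact q (n + 1))
                * rqgam q (b - zc n) * (Q' - Q * Q')).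
  - rewrite E. ring.
  - replace (qpow q (zc n * (zc n - 1) / 2 - b * zc n)) with (P * Q').
    + ring.
    + unfold P, Q'. rewrite <- qpow_add. f_equal. ring.
Qed.

Lemma gauss_hasSum q b n : (0 < q < 1)%R ->
  hasSum (gauss_term q b n) (gauss_sum q b n).
Proof.
  intros Hq. destruct (Z_lt_le_dec n 0) as [Hn|Hn].
  { unfold gauss_sum. rewrite rqfact_neg, Cmult_0_r, Cmult_0_l by auto.
    apply hasSum_zero. intros i. unfold gauss_term.
    destruct (Z_lt_le_dec i 0) as [Hi|Hi].
    - rewrite (rqfact_neg q i) by auto. ring.
    - rewrite (rqfact_neg q (n - i)) by lia. ring. }
  rewrite <- (Z2Nat.id n Hn). induction (Z.to_nat n) as [|k IH].
  - replace (gauss_sum q b (Z.of_nat 0)) with (gauss_term q b 0 0).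
    + apply hasSum_single. intros i Hi. unfold gauss_term.
      destruct (Z_lt_le_dec i 0) as [Hi'|Hi'].
      * rewrite (rqfact_neg q i) by auto. ring.
      * rewrite (rqfact_neg q (0 - i)) by lia. ring.
    + unfold gauss_term, gauss_sum. simpl Z.of_nat. simpl (0 - 0)%Z. rewrite rqfact_0.
      replace (b - 0) with b by ring. ring.
  - replace (Z.of_nat (S k)) with (Z.of_nat k + 1)%Z by lia.
    set (n' := Z.of_nat k) in *.
    assert (1 - qpow q (zc (n' + 1)) <> 0) as Hne.
    { apply qpow_neq_1; auto. apply eq_IZR_contrapositive. lia. }
    set (d := 1 - qpow q (zc (n' + 1))) in *.
    replace (gauss_sum q b (n' + 1))
      with (/ d * (gauss_sum q b n' + (- qpow q (zc n' - b)) * gauss_sum q b n')).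
    + apply hasSum_ext with (fun i => / d * (gauss_term q b n' i
          + (- qpow q (zc n' - b)) * gauss_term q b n' (i + -1))).
      * intros i. change (i + -1)%Z with (i - 1)%Z. rewrite <- gauss_term_rec by auto.
        fold d. rewrite Cmult_assoc, Cinv_l by auto. ring.
      * apply hasSum_scal, hasSum_plus; auto. apply hasSum_scal. now apply hasSum_shift.
    + transitivity (/ d * ((1 - qpow q (zc n' - b)) * gauss_sum q b n')); [ring|].
      rewrite <- gauss_sum_rec by auto. fold d.
      rewrite Cmult_assoc, Cinv_l by auto. ring.
Qed.

(** * The fourfold sum *)

(** The second factor of the theorem's summand is $J_{x-\nu}(q^{z/2};q)$ and the first is
    $J_x(q^{(m+z)/2};q)$; both are expanded in the exchanged form given by [heJ_sym]. *)
Definition quad_term (q : R) (m : Z) (x y nu : C) (p : Z * Z * Z * Z) : C :=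
  let '(z, i, j, k) := p in
  qpow q (zc z) * he_term q (zc (m + z)) x i * he_term q (zc z) (x - nu) j
  * he_term q nu (y + nu + zc z) k.

(** For $z<0$ the term $zk$ is controlled by $|z|k\le\frac34z^2+\frac13k^2$, and $z^2$ by the
    mean of $(i+M)^2\le\frac{10}9i^2+10M^2$ and the same bound in $j$.  At least $\frac1{12}$ of each
    square is left, which absorbs the linear terms. *)
Lemma exponent_lower d M a b c : (0 < d)%R -> (0 <= M)%R ->
  exists K, forall z i j k : R, (0 <= i)%R -> (0 <= j)%R -> (0 <= k)%R ->
    (- M <= z + i)%R -> (- M <= z + j)%R ->
    (d * (Rabs z + i + j + k) - K
     <= i * i / 2 + j * j / 2 + k * k / 2 + z * k + d * z + a * i + b * j + c * k)%R.
Proof.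
  intros Hd HM.
  exists (3 * Rsqr (a - 3 * d) + 3 * Rsqr (b - d) + 3 * Rsqr (c - d)
          + 15 / 2 * Rsqr M + 2 * d * M)%R.
  intros z i j k Hi Hj Hk Hzi Hzj.
  pose proof (Rle_0_sqr (i + 6 * (a - 3 * d))) as S1.
  pose proof (Rle_0_sqr (j + 6 * (b - d))) as S2.
  pose proof (Rle_0_sqr (k + 6 * (c - d))) as S3.
  pose proof (Rmult_le_pos d i) as Hdi. pose proof (Rmult_le_pos d M) as HdM.
  pose proof (Rle_0_sqr M). pose proof (Rle_0_sqr i). pose proof (Rle_0_sqr j).
  pose proof (Rle_0_sqr k).
  unfold Rsqr in *.
  destruct (Rle_lt_dec 0 z) as [Hz|Hz].
  - rewrite Rabs_pos_eq by auto.
    pose proof (Rmult_le_pos z k Hz Hk). lra.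
  - rewrite Rabs_left by auto.
    assert (d * - z <= d * (i + M))%R by (apply Rmult_le_compat_l; lra).
    assert (z * z <= (i + M) * (i + M))%R as Z1 by nra.
    assert (z * z <= (j + M) * (j + M))%R as Z2 by nra.
    pose proof (Rle_0_sqr (3 * z + 2 * k)) as S4.
    pose proof (Rle_0_sqr (i - 9 * M)) as S5.
    pose proof (Rle_0_sqr (j - 9 * M)) as S6.
    unfold Rsqr in *. lra.
Qed.

Ltac vanish n :=
  match goal with |- (Cmod ?e <= _)%R =>
    replace e with (RtoC 0) by (rewrite (rqfact_neg _ n) by assumption; ring);
    rewrite Cmod_0; assumption
  end.

(** Off the support the term is zero; on it [exponent_lower] gives a product of geometric
    majorants in the four indices. *)
Lemma quad_term_bounded q m x y nu : (0 < q < 1)%R -> (-1 < Re x)%R ->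
  abs_bounded (quad_term q m x y nu).
Proof.
  intros Hq Hx. destruct (rqfact_bounded q Hq) as (H & HH & Hb).
  destruct (rqgam_bounded q (Re nu) Hq) as (G & HG & HGb).
  destruct (exponent_lower (1 + Re x) (Rabs (IZR m)) (1 / 2 + Re x)
              (1 / 2 + Re (x - nu)) (1 / 2 + Re (y + nu))) as [K HK];
    [lra|apply Rabs_pos|].
  set (d := (1 + Re x)%R) in *.
  set (e0 := (Re (x * zc m / 2) + Re ((y + nu) * nu / 2))%R).
  destruct (geometric_bounded q d Hq) as [B HB]; [unfold d; lra|].
  set (w := fun n : Z => Rpower q (d * Rabs (IZR n))) in *.
  assert (forall n, 0 <= w n)%R as Hw by (intros; left; apply Rpower_pos).
  set (c := (H * H * H * H * H * G * Rpower q (e0 - K))%R).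
  assert (0 <= c)%R as Hc.
  { unfold c. repeat apply Rmult_le_pos; auto. left; apply Rpower_pos. }
  apply abs_bounded_le with
    (c := c) (g := fun p => (w (fst (fst (fst p))) * w (snd (fst (fst p)))
                             * w (snd (fst p)) * w (snd p))%R)
    (B := (B * B * B * B)%R); auto.
  { apply (sum_bounded_prod (fun p : Z * Z * Z =>
             w (fst (fst p)) * w (snd (fst p)) * w (snd p))%R w); auto.
    { intros; repeat apply Rmult_le_pos; auto. }
    apply (sum_bounded_prod (fun p : Z * Z => w (fst p) * w (snd p))%R w); auto.
    { intros; repeat apply Rmult_le_pos; auto. }
    apply sum_bounded_prod; auto. }
  intros [[[z i] j] k]. simpl fst. simpl snd.
  assert (0 <= c * (w z * w i * w j * w k))%R as Hrhs
    by (repeat (apply Rmult_le_pos; auto)).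
  unfold quad_term, he_term.
  rewrite <- !RtoC_plus, <- !plus_IZR, !rqgam_int by auto.
  destruct (Z_lt_le_dec i 0) as [Hi|Hi].
  { vanish i. }
  destruct (Z_lt_le_dec j 0) as [Hj|Hj].
  { vanish j. }
  destruct (Z_lt_le_dec k 0) as [Hk|Hk].
  { vanish k. }
  destruct (Z_lt_le_dec (m + z + i) 0) as [Hzi|Hzi].
  { vanish (m + z + i)%Z. }
  destruct (Z_lt_le_dec (z + j) 0) as [Hzj|Hzj].
  { vanish (z + j)%Z. }
  rewrite !Cmod_mult, !Cmod_sgn, !Cmod_qpow.
  rewrite !plus_IZR, !RtoC_plus.
  set (E1 := Re (zc z)). set (E2 := Re (_ + _ + _ / 2)).
  set (E3 := Re (_ + _ + (x - nu) * _ / 2)).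
  set (E4 := Re (_ + _ + _ * nu / 2)).
  assert (Rpower q E1 * Rpower q E2 * Rpower q E3 * Rpower q E4
          <= Rpower q (e0 - K) * (w z * w i * w j * w k))%R as HE.
  { unfold w. rewrite <- !Rpower_plus. apply Rpower_antitone; auto.
    apply IZR_le in Hi, Hj, Hk, Hzi, Hzj. rewrite !plus_IZR in *.
    assert (- Rabs (IZR m) <= IZR z + IZR i)%R as H1.
    { pose proof (Rle_abs (IZR m)). lra. }
    assert (- Rabs (IZR m) <= IZR z + IZR j)%R as H2.
    { pose proof (Rabs_pos (IZR m)). lra. }
    specialize (HK (IZR z) (IZR i) (IZR j) (IZR k) Hi Hj Hk H1 H2).
    rewrite (Rabs_pos_eq (IZR i)), (Rabs_pos_eq (IZR j)), (Rabs_pos_eq (IZR k)) by auto.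
    match goal with |- (?A <= ?B)%R =>
      replace B with (e0 + (IZR i * IZR i / 2 + IZR j * IZR j / 2 + IZR k * IZR k / 2 +
        IZR z * IZR k + d * IZR z + (1 / 2 + Re x) * IZR i
        + (1 / 2 + Re (x - nu)) * IZR j + (1 / 2 + Re (y + nu)) * IZR k))%R; [lra|] end.
    unfold E1, E2, E3, E4, e0, d. clear.
    destruct x as [x x'], y as [y y'], nu as [nu nu'].
    unfold Cdiv, Cinv, Cmult, Cplus, Cminus, Copp, RtoC, Re; simpl. field. }
  assert (Re nu <= Re (nu + zc k))%R as Hnu.
  { rewrite re_plus, re_RtoC. apply IZR_le in Hk. lra. }
  specialize (HGb _ Hnu).
  unfold c.
  replace (H * H * H * H * H * G * Rpower q (e0 - K) * (w z * w i * w j * w k))%R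
    with (H * H * H * H * H * G * (Rpower q (e0 - K) * (w z * w i * w j * w k)))%R by ring.
  replace (Rpower q E1 * (1 * Rpower q E2 * Cmod (rqfact q i) * Cmod (rqfact q (m + z + i)))
    * (1 * Rpower q E3 * Cmod (rqfact q j) * Cmod (rqfact q (z + j)))
    * (1 * Rpower q E4 * Cmod (rqfact q k) * Cmod (rqgam q (nu + zc k))))%R
    with (Cmod (rqfact q i) * Cmod (rqfact q (m + z + i)) * Cmod (rqfact q j)
      * Cmod (rqfact q (z + j)) * Cmod (rqfact q k) * Cmod (rqgam q (nu + zc k))
      * (Rpower q E1 * Rpower q E2 * Rpower q E3 * Rpower q E4))%R by ring.
  assert (0 <= Rpower q E1 * Rpower q E2 * Rpower q E3 * Rpower q E4)%R as HE0
    by (repeat apply Rmult_le_pos; left; apply Rpower_pos).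
  generalize dependent (Rpower q E1 * Rpower q E2 * Rpower q E3 * Rpower q E4)%R.
  generalize (Rpower q (e0 - K) * (w z * w i * w j * w k))%R. intros W P HP HP0.
  repeat (apply Rmult_le_compat; repeat apply Rmult_le_pos; auto using Cmod_ge_0).
Qed.

(** * Summation in the two orders *)

(** The substitution $z=p-i-j$, $k=p+l$.  Here $p=i+(z+j)$ is the total power of $1/t$ in the
    product of the generating functions, and $m+p=j+(m+z+i)$ is that of $t$. *)
Definition regroup (t : Z * Z * Z * Z) : Z * Z * Z * Z :=
  let '(p, l, i, j) := t in ((p - i - j)%Z, i, j, (p + l)%Z).

Definition outer_coef (q : R) (m : Z) (x y nu : C) (p l : Z) : C :=
  sgn (p + l)
  * qpow q (zc (p + l) * (zc (p + l) + 1) / 2 + zc p * (1 + x + zc (p + l))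
            + x * zc m / 2 + (y + nu) * nu / 2 + (y + nu) * zc (p + l)).

Lemma quad_term_regroup q m x y nu p l i j : (0 < q < 1)%R ->
  quad_term q m x y nu (regroup (p, l, i, j))
  = outer_coef q m x y nu p l * gauss_term q (zc (p + l)) p i
    * gauss_term q (nu + zc (p + l)) (m + p) j.
Proof.
  intros Hq. unfold quad_term, regroup, he_term, outer_coef, gauss_term.
  rewrite <- !RtoC_plus, <- !plus_IZR, !rqgam_int by auto.
  replace (m + (p - i - j) + i)%Z with (m + p - j)%Z by lia.
  replace (p - i - j + j)%Z with (p - i)%Z by lia.
  set (k := (p + l)%Z). set (z := (p - i - j)%Z).
  match goal with |- qpow q ?e1 * (_ * qpow q ?e2 * _ * _) * (_ * qpow q ?e3 * _ * _)
       * (_ * qpow q ?e4 * _ * _) = _ * qpow q ?f1 * (_ * qpow q ?f2 * _ * _ * _)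
       * (_ * qpow q ?f3 * _ * _ * _) =>
    assert (qpow q e1 * qpow q e2 * qpow q e3 * qpow q e4
            = qpow q f1 * qpow q f2 * qpow q f3) as E;
    [rewrite <- !qpow_add; f_equal; unfold z; zcs; field|];
    set (P1 := qpow q e1) in *; set (P2 := qpow q e2) in *; set (P3 := qpow q e3) in *;
    set (P4 := qpow q e4) in *; set (Q1 := qpow q f1) in *; set (Q2 := qpow q f2) in *;
    set (Q3 := qpow q f3) in * end.
  transitivity ((P1 * P2 * P3 * P4) * (sgn i * sgn j * sgn k * rqfact q i * rqfact q j
    * rqfact q k * rqfact q (m + p - j) * rqfact q (p - i) * rqgam q (nu + zc k))).
  - ring.
  - rewrite E. ring.
Qed.

(** Here $g(k-p)=h(l)$ and $g(\nu+k-(m+p))=g(\nu-m+l)$ for $k=p+l$. *)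
Lemma outer_coef_gauss q m x y nu p l : (0 < q < 1)%R ->
  outer_coef q m x y nu p l * gauss_sum q (zc (p + l)) p
    * gauss_sum q (nu + zc (p + l)) (m + p)
  = sgn m * qpow q (- (zc m / 2)) * he_term q (zc m) (x + y) p
    * he_term q (nu - zc m) (y + nu - zc m) l.
Proof.
  intros Hq. unfold outer_coef, gauss_sum, he_term.
  replace (zc (p + l) - zc p) with (zc l) by (zcs; ring).
  replace (nu + zc (p + l) - zc (m + p)) with (nu - zc m + zc l) by (zcs; ring).
  rewrite <- !RtoC_plus, <- !plus_IZR, !rqgam_int by auto.
  match goal with |- _ * qpow q ?e1 * (_ * qpow q ?e2 * _ * _) * (_ * qpow q ?e3 * _ * _)
       = _ * qpow q ?f1 * (_ * qpow q ?f2 * _ * _) * (_ * qpow q ?f3 * _ * _) =>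
    assert (qpow q e1 * qpow q e2 * qpow q e3
            = qpow q f1 * qpow q f2 * qpow q f3) as E;
    [rewrite <- !qpow_add; f_equal; zcs; field|];
    set (P1 := qpow q e1) in *; set (P2 := qpow q e2) in *; set (P3 := qpow q e3) in *;
    set (Q1 := qpow q f1) in *; set (Q2 := qpow q f2) in *;
    set (Q3 := qpow q f3) in * end.
  rewrite !sgn_add.
  transitivity ((P1 * P2 * P3) * ((sgn p * sgn p) * (sgn p * sgn l * sgn m) * rqfact q l
    * rqfact q p * rqfact q (m + p) * rqgam q (nu - zc m + zc l))).
  - ring.
  - rewrite E, sgn_sqr. ring.
Qed.

Lemma quad_sum_by_z q m x y nu s : (0 < q < 1)%R -> (-1 < Re x)%R ->
  hasSum (quad_term q m x y nu) s ->
  is_bilateral_series (fun z => qpow q (zc z) * heJ q x (zc (m + z))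
     * heJ q (x - nu) (zc z) * heJ q nu (y + nu + zc z)) s.
Proof.
  intros Hq Hx Hs.
  pose proof (quad_term_bounded q m x y nu Hq Hx) as Hb.
  set (f3 := fun p : Z * Z * Z => let '(z, i, j) := p in
    qpow q (zc z) * he_term q (zc (m + z)) x i * he_term q (zc z) (x - nu) j
    * heJ q nu (y + nu + zc z)).
  set (f2 := fun p : Z * Z => let '(z, i) := p in
    qpow q (zc z) * he_term q (zc (m + z)) x i * heJ q (x - nu) (zc z)
    * heJ q nu (y + nu + zc z)).
  assert (forall p, hasSum (fun k => quad_term q m x y nu (p, k)) (f3 p)) as H3.
  { intros [[z i] j]. apply hasSum_scal. now apply heJ_hasSum. }
  assert (forall p, hasSum (fun j => f3 (p, j)) (f2 p)) as H2.
  { intros [z i].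
    replace (f2 (z, i)) with (qpow q (zc z) * he_term q (zc (m + z)) x i
      * heJ q nu (y + nu + zc z) * heJ q (zc z) (x - nu))
      by (unfold f2; rewrite (heJ_sym q (x - nu)) by auto; ring).
    apply hasSum_ext with (fun j => qpow q (zc z) * he_term q (zc (m + z)) x i
      * heJ q nu (y + nu + zc z) * he_term q (zc z) (x - nu) j).
    - intros j. unfold f3. ring.
    - apply hasSum_scal. now apply heJ_hasSum. }
  assert (forall z, hasSum (fun i => f2 (z, i)) (qpow q (zc z) * heJ q x (zc (m + z))
     * heJ q (x - nu) (zc z) * heJ q nu (y + nu + zc z))) as H1.
  { intros z. rewrite (heJ_sym q x) by auto.
    replace (qpow q (zc z) * heJ q (zc (m + z)) x
             * heJ q (x - nu) (zc z) * heJ q nu (y + nu + zc z))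
      with (qpow q (zc z) * heJ q (x - nu) (zc z) * heJ q nu (y + nu + zc z)
            * heJ q (zc (m + z)) x) by ring.
    apply hasSum_ext with (fun i => qpow q (zc z) * heJ q (x - nu) (zc z)
       * heJ q nu (y + nu + zc z) * he_term q (zc (m + z)) x i).
    - intros i. unfold f2. ring.
    - apply hasSum_scal. now apply heJ_hasSum. }
  apply hasSum_bilateral.
  - apply abs_bounded_fiberwise with (2 := H1), abs_bounded_fiberwise with (2 := H2),
      abs_bounded_fiberwise with (2 := H3), Hb.
  - apply hasSum_fiberwise with (2 := H1), hasSum_fiberwise with (2 := H2),
      hasSum_fiberwise with (2 := H3), Hs.
Qed.

Lemma quad_sum_by_powers q m x y nu s : (0 < q < 1)%R ->
  hasSum (quad_term q m x y nu) s ->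
  s = sgn m * qpow q (- (zc m / 2)) * heJ q (zc m) (x + y)
      * heJ q (nu - zc m) (y + nu - zc m).
Proof.
  intros Hq Hs.
  assert (hasSum (fun t => quad_term q m x y nu (regroup t)) s) as H0.
  { apply (hasSum_reindex regroup); auto.
    - intros [[[p l] i] j] [[[p' l'] i'] j'] [=]. repeat f_equal; lia.
    - intros [[[z i] j] k] _. exists ((z + i + j)%Z, (k - (z + i + j))%Z, i, j).
      unfold regroup. repeat f_equal; lia. }
  set (f3 := fun t : Z * Z * Z => let '(p, l, i) := t in
    outer_coef q m x y nu p l * gauss_term q (zc (p + l)) p i
    * gauss_sum q (nu + zc (p + l)) (m + p)).
  set (f2 := fun t : Z * Z => let '(p, l) := t in
    outer_coef q m x y nu p l * gauss_sum q (zc (p + l)) p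
    * gauss_sum q (nu + zc (p + l)) (m + p)).
  set (c := sgn m * qpow q (- (zc m / 2))).
  assert (forall t, hasSum (fun j => quad_term q m x y nu (regroup (t, j))) (f3 t)) as H3.
  { intros [[p l] i].
    apply hasSum_ext with (fun j => outer_coef q m x y nu p l
       * gauss_term q (zc (p + l)) p i * gauss_term q (nu + zc (p + l)) (m + p) j).
    - intros j. now rewrite quad_term_regroup.
    - apply hasSum_scal. now apply gauss_hasSum. }
  assert (forall t, hasSum (fun i => f3 (t, i)) (f2 t)) as H2.
  { intros [p l]. 
    replace (f2 (p, l)) with (outer_coef q m x y nu p l
       * gauss_sum q (nu + zc (p + l)) (m + p) * gauss_sum q (zc (p + l)) p)
      by (unfold f2; ring).
    apply hasSum_ext with (fun i => outer_coef q m x y nu p l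
       * gauss_sum q (nu + zc (p + l)) (m + p) * gauss_term q (zc (p + l)) p i).
    - intros i. unfold f3. ring.
    - apply hasSum_scal. now apply gauss_hasSum. }
  assert (forall p, hasSum (fun l => f2 (p, l)) (c * he_term q (zc m) (x + y) p
            * heJ q (nu - zc m) (y + nu - zc m))) as H1.
  { intros p. apply hasSum_ext with (fun l => c * he_term q (zc m) (x + y) p
                 * he_term q (nu - zc m) (y + nu - zc m) l).
    - intros l. unfold f2, c. now rewrite outer_coef_gauss.
    - apply hasSum_scal. now apply heJ_hasSum. }
  assert (hasSum (fun p => c * he_term q (zc m) (x + y) p
            * heJ q (nu - zc m) (y + nu - zc m)) s) as H.
  { apply hasSum_fiberwise with (2 := H1), hasSum_fiberwise with (2 := H2),
      (hasSum_fiberwise (fun t => quad_term q m x y nu (regroup t))) with (2 := H3), H0. }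
  apply hasSum_unique with (1 := H).
  apply hasSum_ext with (fun p => c * heJ q (nu - zc m) (y + nu - zc m)
                                  * he_term q (zc m) (x + y) p).
  - intros p. ring.
  - replace (c * heJ q (zc m) (x + y) * heJ q (nu - zc m) (y + nu - zc m))
      with (c * heJ q (nu - zc m) (y + nu - zc m) * heJ q (zc m) (x + y)) by ring.
    apply hasSum_scal. now apply heJ_hasSum.
Qed.

(** $R=q^\rho$ with $\rho=\log R/\log q$ for the chosen logarithm, so that
    $R^\alpha q^{a\alpha/2}=q^{\alpha(a+2\rho)/2}$. *)
Lemma hahn_exton_at_heJ q al r lr a : (0 < q < 1)%R -> Cexp lr = r ->
  hahn_exton_at q al r lr (a / 2) = heJ q al (a + 2 * (lr / RtoC (ln q))).
Proof.
  intros Hq Hr. assert (RtoC (ln q) <> 0) as Hln.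
  { intros H. apply RtoC_inj in H.
    assert (ln q < ln 1)%R by (apply ln_increasing; lra). rewrite ln_1 in *. lra. }
  set (rho := lr / RtoC (ln q)).
  assert (forall b, Cexp (b * lr) = qpow q (b * rho)) as E.
  { intros b. unfold qpow, rho. f_equal. field. auto. }
  unfold hahn_exton_at, heJ, hahn_exton_q.
  rewrite <- Hr, <- (Cmult_1_l lr) at 1. rewrite !E, Cmult_1_l, <- !qpow_add.
  f_equal; f_equal; field.
Qed.

Theorem mainTheorem2 :
  forall (q : R) (m : Z) (r lr x y nu : C),
    (0 < q < 1)%R ->
    r <> RtoC 0 ->
    Cexp lr = r ->
    (-1 < Re x)%R ->
    (Rpower q (1 + Re x + Re y) * Cmod r ^ 2 < 1)%R ->
    is_bilateral_series
      (fun z : Z =>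
         qpow q (RtoC (IZR z))
         * hahn_exton_q q x ((RtoC (IZR m) + RtoC (IZR z)) / RtoC 2)
         * hahn_exton_q q (x - nu) (RtoC (IZR z) / RtoC 2)
         * hahn_exton_at q nu r lr ((y + nu + RtoC (IZR z)) / RtoC 2))
      (RtoC (powerRZ (-1) m) * qpow q (- (RtoC (IZR m) / RtoC 2))
       * hahn_exton_at q (RtoC (IZR m)) r lr ((x + y) / RtoC 2)
       * hahn_exton_at q (nu - RtoC (IZR m)) r lr
           ((y + nu - RtoC (IZR m)) / RtoC 2)).
Proof.
  intros q m r lr x y nu Hq _ Hr Hx _.
  set (y' := y + 2 * (lr / RtoC (ln q))).
  destruct (abs_bounded_hasSum _ (quad_term_bounded q m x y' nu Hq Hx)) as [s Hs].
  assert (forall z : Z,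
    qpow q (zc z) * heJ q x (zc (m + z)) * heJ q (x - nu) (zc z) * heJ q nu (y' + nu + zc z)
    = qpow q (zc z) * hahn_exton_q q x ((zc m + zc z) / 2)
      * hahn_exton_q q (x - nu) (zc z / 2)
      * hahn_exton_at q nu r lr ((y + nu + zc z) / 2)) as Hterm.
  { intros z. rewrite (hahn_exton_at_heJ q nu r lr) by auto.
    rewrite plus_IZR, RtoC_plus.
    replace (y' + nu + zc z) with (y + nu + zc z + 2 * (lr / RtoC (ln q)))
      by (unfold y'; ring).
    reflexivity. }
  apply is_bilateral_series_ext with (1 := Hterm).
  match goal with |- is_bilateral_series _ ?t => replace t with s end.
  - now apply quad_sum_by_z.
  - rewrite (quad_sum_by_powers q m x y' nu s Hq Hs).
    rewrite !(hahn_exton_at_heJ q _ r lr), sgn_powerRZ by auto.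
    replace (x + y') with (x + y + 2 * (lr / RtoC (ln q))) by (unfold y'; ring).
    replace (y' + nu - zc m) with (y + nu - zc m + 2 * (lr / RtoC (ln q)))
      by (unfold y'; ring).
    reflexivity.
Qed.
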